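(* Let $B_1,B_2\subset\mathbb{R}^2$ be two disks of the same radius $r>0$ separated by a distance $\epsilon>0$, with conductivity $k$, $0<k\neq1<\infty$, and let $\lambda=\frac{k+1}{2(k-1)}$. Let $\alpha=\sqrt{\epsilon(r+\epsilon/4)}$, $\xi_0=\sinh^{-1}(\alpha/r)$ and $\lambda_{\epsilon,n}^+=\frac12e^{-2|n|\xi_0}$ for nonzero integers $n$. Then the $(1,1)$-entry $m_{11}^\epsilon$ of the first-order polarization tensor of the two disks is $$m_{11}^\epsilon=\sum_{n\neq0}\frac{4\pi\alpha^2|n|e^{-2|n|\xi_0}}{\lambda-\lambda_{\epsilon,n}^+}=8\pi\alpha^2\sum_{n=1}^\infty\frac{n\,e^{-2n\xi_0}}{\lambda-\frac12e^{-2n\xi_0}}.$$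
   Context: Cartesian coordinates $(x_1,x_2)$ are chosen so that the centers of the disks lie on the $x_1$-axis, symmetrically about the origin, with $B_1$ in $\{x_1<0\}$ and $B_2$ in $\{x_1>0\}$. For a disk $B$ with outward unit normal $\nu$, let $$\mathcal{S}_{B}[\varphi](x)=\frac1{2\pi}\int_{\partial B}\ln|x-y|\,\varphi(y)\,d\sigma(y)\ (x\in\mathbb{R}^2),\qquad \mathcal{K}_{B}^*[\varphi](x)=\frac1{2\pi}\int_{\partial B}\frac{\langle x-y,\nu_x\rangle}{|x-y|^2}\varphi(y)\,d\sigma(y)\ (x\in\partial B).$$ With $\nu^{(i)}$ the outward unit normal on $\partial B_i$, define on $L^2(\partial B_1)\times L^2(\partial B_2)$ the Neumann-Poincaré operator $$\mathbb{K}_\epsilon^*=\begin{bmatrix}\mathcal{K}_{B_1}^*&\frac{\partial}{\partial\nu^{(1)}}\mathcal{S}_{B_2}\\ \frac{\partial}{\partial\nu^{(2)}}\mathcal{S}_{B_1}&\mathcal{K}_{B_2}^*\end{bmatrix},$$ where the first row is evaluated on $\partial B_1$ and the second on $\partial B_2$. The $(1,1)$-entry of the first-order polarization tensor is $$m_{11}^\epsilon=\left\langle\phi,(\lambda\mathbb{I}-\mathbb{K}_\epsilon^* )^{-1}[\psi]\right\rangle,\qquad \phi=\begin{bmatrix}x_1|_{\partial B_1}\\ x_1|_{\partial B_2}\end{bmatrix},\quad\psi=\begin{bmatrix}\nu_1|_{\partial B_1}\\ \nu_1|_{\partial B_2}\end{bmatrix},$$ where $\nu_1$ is the first component of the outward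 unit normal and $\langle f,g\rangle=\sum_{j=1}^2\int_{\partial B_j}f_j\overline{g_j}\,d\sigma$. *)

(* Defs.v *)
From HB Require Import structures.
From mathcomp Require Import all_boot all_order all_algebra.
From mathcomp Require Import all_classical all_reals all_analysis.
From mathcomp Require Import complex ring.
From mathcomp.analysis Require showcase.summability.

Set Implicit Arguments.
Unset Strict Implicit.
Unset Printing Implicit Defensive.

Import Order.TTheory GRing.Theory Num.Theory.
Import numFieldNormedType.Exports.

Local Open Scope classical_set_scope.
Local Open Scope ring_scope.
Local Open Scope complex_scope.

(* MathComp-Analysis has no hyperbolic functions. *)
Definition sinh (R : realType) (x : R) : R := (expR x - expR (- x)) / 2.
Definition asinh (R : realType) (x : R) : R := ln (x + Num.sqrt (x ^+ 2 + 1)).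

Lemma asinhK (R : realType) : cancel (@asinh R) (@sinh R).
Proof.
move=> x; rewrite /sinh /asinh; set s := Num.sqrt _.
have s2 : s ^+ 2 = x ^+ 2 + 1 by rewrite sqr_sqrtr// addr_ge0// sqr_ge0.
have xs : `|x| < s by rewrite -sqrtr_sqr ltr_sqrt ?ltrDl// ltr_wpDl// sqr_ge0.
have p0 : 0 < x + s.
  by rewrite -ltrBlDl sub0r; move: xs; rewrite ltr_norml ltrNl => /andP[].
rewrite expRN lnK ?posrE//.
have -> : (x + s)^-1 = s - x.
  apply: (mulfI (lt0r_neq0 p0)); rewrite mulfV ?lt0r_neq0//.
  by rewrite mulrC [x + s]addrC -subr_sqr s2 addrAC subrr add0r.
by field.
Qed.

Section Plane.
Variable R : realType.
Implicit Types (c x y : R * R) (r : R).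

Definition dot x y : R := x.1 * y.1 + x.2 * y.2.

(* The library norm on [R * R] is the sup norm. *)
Definition enorm x : R := Num.sqrt (dot x x).

(* Unit-speed parametrization of the circle of center [c] and radius [r], so
   that Lebesgue measure in [s] over one period is the arc length. *)
Definition arc_param c r (s : measurableTypeR R) :
    (measurableTypeR R * measurableTypeR R)%type :=
  (c.1 + r * cos (s / r), c.2 + r * sin (s / r)).

Lemma arc_param_circle c r s : 0 <= r -> enorm (arc_param c r s - c) = r.
Proof.
move=> r0; rewrite /enorm /dot /arc_param /= ![_ + _ * _ - _]addrC !addKr.
by rewrite -!expr2 !exprMn -mulrDr cos2Dsin2 mulr1 sqrtr_sqr ger0_norm.
Qed.

Lemma measurable_arc_param c r : measurable_fun setT (arc_param c r).
Proof.
apply: measurable_fun_pair; apply: measurable_realfun.continuous_measurable_fun => s /=.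
- apply: cvgD; first exact: cvg_cst.
  apply: cvgMr; apply: (@continuous_comp _ _ _ (fun s : R => s / r) (@cos R)).
    exact: mulrr_continuous.
  exact: continuous_cos.
- apply: cvgD; first exact: cvg_cst.
  apply: cvgMr; apply: (@continuous_comp _ _ _ (fun s : R => s / r) (@sin R)).
    exact: mulrr_continuous.
  exact: continuous_sin.
Qed.

HB.instance Definition _ c r :=
  isMeasurableFun.Build _ _ _ _ (arc_param c r) (measurable_arc_param c r).

(* Arc length measure on the circle, as a measure on the plane. *)
Definition arclength c r :=
  pushforward (mrestr (@lebesgue_measure R) (measurable_itv `[0, 2 * pi * r[))
    (arc_param c r).

Let arclength0 c r : arclength c r set0 = 0%E.
Proof. exact: measure0. Qed.
Let arclength_ge0 c r A : (0 <= arclength c r A)%E.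
Proof. exact: measure_ge0. Qed.
Let arclength_sigma_additive c r : semi_sigma_additive (arclength c r).
Proof. exact: measure_semi_sigma_additive. Qed.

HB.instance Definition _ c r := isMeasure.Build _ _ _ (arclength c r)
  (arclength0 c r) (@arclength_ge0 c r) (@arclength_sigma_additive c r).

End Plane.

Section Potentials.
Variable R : realType.
Implicit Types (c x y : R * R) (r : R) (f g : R * R -> R[i]).

(* The integral over the boundary of the disk of center [c], radius [r]. *)
Definition bint c r f : R[i] :=
  (\int[arclength c r]_y complex.Re (f y))
    +i* (\int[arclength c r]_y complex.Im (f y)).

Definition bL2 c r f : Prop :=
  ((fun y => complex.Re (f y)) \in Lfun (arclength c r) 2%:E) /\
  ((fun y => complex.Im (f y)) \in Lfun (arclength c r) 2%:E).

(* The outward unit normal at [x], for [x] on the circle. *)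
Definition normal c r x : R * R := r^-1 *: (x - c).

Definition single_layer c r f x : R[i] :=
  ((2 * pi)^-1)%:C * bint c r (fun y => (ln (enorm (x - y)))%:C * f y).

(* The kernel is [0 / 0 = 0] at [y = x], a null set for the arc length. *)
Definition Kstar c r f x : R[i] :=
  ((2 * pi)^-1)%:C *
  bint c r (fun y => (dot (x - y) (normal c r x) / enorm (x - y) ^+ 2)%:C * f y).

Definition normal_derivative c r (u : R * R -> R[i]) x : R[i] :=
  'D_(normal c r x) (fun z => complex.Re (u z)) x
    +i* 'D_(normal c r x) (fun z => complex.Im (u z)) x.

End Potentials.

Section TwoDisks.
Variable R : realType.
Implicit Types (r eps lam : R).

(* A pair of densities, on the boundaries of the first and the second disk.
   They are functions on the plane that only matter up to equality almost
   everywhere for the arc length of the corresponding circle. *)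
Definition density2 : Type := ((R * R -> R[i]) * (R * R -> R[i]))%type.
Implicit Types f g h : density2.

Definition center1 r eps : R * R := (- (r + eps / 2), 0).
Definition center2 r eps : R * R := (r + eps / 2, 0).

Definition L2 r eps f : Prop :=
  bL2 (center1 r eps) r f.1 /\ bL2 (center2 r eps) r f.2.

Definition eqL2 r eps f g : Prop :=
  (f.1 = g.1 %[ae arclength (center1 r eps) r]) /\
  (f.2 = g.2 %[ae arclength (center2 r eps) r]).

Definition NPop r eps f : density2 :=
  let c1 := center1 r eps in let c2 := center2 r eps in
  (fun x => Kstar c1 r f.1 x
            + normal_derivative c1 r (single_layer c2 r f.2) x,
   fun x => normal_derivative c2 r (single_layer c1 r f.1) x
            + Kstar c2 r f.2 x).

Definition resolvent_op r eps lam f : density2 :=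
  (fun x => lam%:C * f.1 x - (NPop r eps f).1 x,
   fun x => lam%:C * f.2 x - (NPop r eps f).2 x).

Definition preimages r eps lam g : set density2 :=
  [set h | L2 r eps h /\ eqL2 r eps (resolvent_op r eps lam h) g].

Definition uniquely_solvable r eps lam g : Prop :=
  exists2 h, preimages r eps lam g h &
    forall h', preimages r eps lam g h' -> eqL2 r eps h' h.

(* [(lam I - K)^-1 [g]], determined as an element of L^2 as soon as
   [uniquely_solvable r eps lam g]. *)
Definition resolvent r eps lam g : density2 :=
  xget (cst 0, cst 0) (preimages r eps lam g).

Definition pairing r eps f g : R[i] :=
  bint (center1 r eps) r (fun x => f.1 x * conjc (g.1 x)) +
  bint (center2 r eps) r (fun x => f.2 x * conjc (g.2 x)).

Definition phi : density2 := (fun x => x.1%:C, fun x => x.1%:C).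
Definition psi r eps : density2 :=
  (fun x => (normal (center1 r eps) r x).1%:C,
   fun x => (normal (center2 r eps) r x).1%:C).

Definition m11 r eps lam : R[i] :=
  pairing r eps phi (resolvent r eps lam (psi r eps)).

Definition alpha r eps : R := Num.sqrt (eps * (r + eps / 4)).
Definition xi0 r eps : R := asinh (alpha r eps / r).
Definition lambda_plus r eps (n : int) : R :=
  2^-1 * expR (- (2 * `|n|%:~R * xi0 r eps)).

(* The family indexed by the nonzero integers. *)
Definition m11_term r eps lam (n : {n : int | n != 0}) : R :=
  4 * pi * alpha r eps ^+ 2 * `|val n|%:~R
    * expR (- (2 * `|val n|%:~R * xi0 r eps))
  / (lam - lambda_plus r eps (val n)).

Definition m11_partial_sum r eps lam (N : nat) : R :=
  \sum_(1 <= n < N.+1)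
    n%:R * expR (- (2 * n%:R * xi0 r eps))
    / (lam - 2^-1 * expR (- (2 * n%:R * xi0 r eps))).

End TwoDisks.
Arguments phi {R}.

(* Main.v *)
(* The solution is built by the method of images. On the boundary of each disk the
   off-diagonal entry of the Neumann-Poincaré operator turns the normal derivative
   of a dipole on the axis into half the normal derivative of the dipole reflected
   in the other circle. Starting from the uniform field, whose normal derivative
   is [psi], repeated reflection gives a geometrically convergent series of image
   dipoles solving the equation, because [|lam| > 1/2]. Each dipole density has
   the same first moment [pi * r ^+ 2], so [m11] is a sum of image strengths,
   [b_m = lam^-1 * (2 * lam)^-m * (sinh xi0 / sinh ((m + 1) * xi0))^2], and expanding
   [1 / sinh^2] turns this sum into the Lambert-type series of the statement.

   Uniqueness: integrating the equations over the circles shows that the densities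
   of a homogeneous solution have mean zero; on such densities the off-diagonal
   operators are [-1/2] times Poisson integrals, which contract the L1 norm. *)
Require Import Defs.
From HB Require Import structures.
From mathcomp Require Import all_boot all_order all_algebra.
From mathcomp Require Import finmap.
From mathcomp Require Import all_classical all_reals all_analysis.
From mathcomp Require Import measurable_realfun complex ring lra zify.
From mathcomp.analysis Require showcase.summability.

Set Implicit Arguments.
Unset Strict Implicit.
Unset Printing Implicit Defensive.

Import Order.TTheory GRing.Theory Num.Theory.
Import numFieldNormedType.Exports.

Local Open Scope classical_set_scope.
Local Open Scope ring_scope.
Local Open Scope complex_scope.

(** On each circle the coordinate z = (y - c) / r has modulus 1, and every integrand met below
    becomes rational in z and its conjugate. Functions analytic in the disk average to their value
    at the center, so the only calculus is the vanishing of the integrals of z^(n+1); the rest is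
    algebra with z * conj z = 1. This is also why reflection works. For x outside a circle, the
    directional derivative of ln |x - y| is the real part of A / (1 - a z). Against the real part of
    z / (1 - q z)^2 the analytic product integrates to 0 and the mixed product is again a dipole;
    the half is that of Re v * Re w = Re (v w + v conj w) / 2. The diagonal entries see only means,
    because the kernel of K* on a circle is the constant 1 / (2 r). Since [resolvent] is a choice
    among preimages, [m11] cannot be evaluated without uniqueness. L1 is the convenient space for
    it: there the norm of an integral operator is read off the integrals of its kernel in x, and the
    sign of the Poisson kernel gives the factor 1/2 exactly, which is what |lam| > 1/2 beats. *)

Local Notation normc := ComplexField.Normc.normc.

(** * Integration along circles *)

Section AlmostEverywhere.
Context d (T : measurableType d) (R : realType) (mu : {measure set T -> \bar R}).
Implicit Types f g : T -> R.

Lemma aeS (P Q : T -> Prop) : (forall x, P x -> Q x) ->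
  {ae mu, forall x, P x} -> {ae mu, forall x, Q x}.
Proof. by move=> PQ; apply: filterS => x; exact: PQ. Qed.

Lemma aeS2 (P Q S : T -> Prop) : (forall x, P x -> Q x -> S x) ->
  {ae mu, forall x, P x} -> {ae mu, forall x, Q x} -> {ae mu, forall x, S x}.
Proof. by move=> PQS; apply: filterS2 => x; exact: PQS. Qed.

(** Domination is asked only almost everywhere because the kernel bounds hold on a circle, while the
    measures live on the whole plane. *)
Lemma ae_integrable f g : measurable_fun setT f ->
  {ae mu, forall x, `|f x| <= g x} -> mu.-integrable setT (EFin \o g) ->
  mu.-integrable setT (EFin \o f).
Proof.
move=> mf fg /integrableP[mg ig]; apply/integrableP; split.
  exact/measurable_EFinP.
apply: le_lt_trans ig; apply: ae_ge0_le_integral => //.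
- by apply/measurable_EFinP; exact: measurableT_comp.
- by apply: measurableT_comp.
- apply: filterS fg => x /= fgx _; rewrite lee_fin.
  exact: le_trans fgx (ler_norm _).
Qed.

Lemma eq_ae_Rintegral f g : measurable_fun setT f -> measurable_fun setT g ->
  {ae mu, forall x, f x = g x} -> \int[mu]_x f x = \int[mu]_x g x.
Proof.
move=> mf mg fg; rewrite /Rintegral; congr fine; apply: ae_eq_integral => //.
- exact/measurable_EFinP.
- exact/measurable_EFinP.
- by apply: filterS fg => x /= -> _.
Qed.

Lemma EFin_Rintegral f : mu.-integrable setT (EFin \o f) ->
  (\int[mu]_x (f x)%:E = (\int[mu]_x f x)%:E)%E.
Proof. by move=> intf; rewrite /Rintegral fineK//; exact: integrable_fin_num. Qed.

Lemma le_ae_Rintegral f g : measurable_fun setT f ->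
  mu.-integrable setT (EFin \o g) -> {ae mu, forall x, `|f x| <= g x} ->
  `|\int[mu]_x f x| <= \int[mu]_x g x.
Proof.
move=> mf ig fg; have intf := ae_integrable mf fg ig.
have mg : measurable_fun setT g by case/integrableP : ig => /measurable_EFinP.
have -> : \int[mu]_x g x = \int[mu]_x `|g x|.
  apply: eq_ae_Rintegral => //; first exact: measurableT_comp.
  by apply: aeS fg => x fgx; rewrite ger0_norm// (le_trans _ fgx).
rewrite -lee_fin EFin_normr_Rintegral//.
rewrite -EFin_Rintegral; last exact: integrable_norm ig.
apply: le_trans (le_abse_integral _ measurableT _) _; first exact/measurable_EFinP.
apply: ae_ge0_le_integral => //.
- by apply: measurableT_comp => //; exact/measurable_EFinP.
- by apply/measurable_EFinP; exact: measurableT_comp.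
- by apply: aeS fg => x fgx _; rewrite lee_fin (le_trans fgx)// ler_norm.
Qed.

End AlmostEverywhere.

Section CircleMeasure.
Variable R : realType.
Implicit Types (c : R * R) (r : R).
Local Notation plane := (measurableTypeR R * measurableTypeR R)%type.

Definition circle c r : set (R * R) := [set y | enorm (y - c) = r].

Lemma measurable_funV d (T : measurableType d) (D : set T) (f : T -> R) :
  measurable_fun D f -> measurable_fun D (fun x => (f x)^-1).
Proof.
move=> mf.
(* The inverse is written with the real power [powR], which is measurable; where [f] vanishes both
   sides are 0. *)
have -> : (fun x => (f x)^-1) = (fun x => f x * ((`|f x| `^ (-1)) ^+ 2)).
  apply/funext => x; rewrite powR_inv1// exprVn real_normK ?num_real//.
  have [->|fx0] := eqVneq (f x) 0; first by rewrite invr0 mul0r.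
  by field.
apply: measurable_funM => //; apply: measurable_funX.
apply: (measurableT_comp (measurable_powR _)).
exact: (measurableT_comp (@normr_measurable R setT)).
Qed.

Lemma measurable_sqrt d (T : measurableType d) (D : set T) (f : T -> R) :
  measurable_fun D f -> measurable_fun D (fun x => Num.sqrt (f x)).
Proof.
move=> mf.
(* On negative arguments [Num.sqrt] is 0, hence the truncation by [Num.max]. *)
have -> : (fun x => Num.sqrt (f x)) = (fun x => (Num.max (f x) 0) `^ 2^-1).
  apply/funext => x; have [fx0|fx0] := leP (f x) 0.
    by rewrite powR0 ?invr_eq0 ?pnatr_eq0// ler0_sqrtr.
  by rewrite powR12_sqrt// ltW.
apply: (measurableT_comp (measurable_powR _)).
exact: measurable_maxr.
Qed.

Lemma measurable_dot d (T : measurableType d) (D : set T) (f g : T -> R * R) :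
  measurable_fun D (fun x => (f x).1) -> measurable_fun D (fun x => (f x).2) ->
  measurable_fun D (fun x => (g x).1) -> measurable_fun D (fun x => (g x).2) ->
  measurable_fun D (fun x => dot (f x) (g x)).
Proof.
by move=> f1 f2 g1 g2; apply: measurable_funD; exact: measurable_funM.
Qed.

Lemma measurable_enorm d (T : measurableType d) (D : set T) (f : T -> R * R) :
  measurable_fun D (fun x => (f x).1) -> measurable_fun D (fun x => (f x).2) ->
  measurable_fun D (fun x => enorm (f x)).
Proof. by move=> f1 f2; apply: measurable_sqrt; exact: measurable_dot. Qed.

Lemma measurable_shift1 c : measurable_fun [set: plane] (fun y : R * R => (y - c).1).
Proof. by apply: measurable_funB => //; exact: measurable_fst. Qed.

Lemma measurable_shift2 c : measurable_fun [set: plane] (fun y : R * R => (y - c).2).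
Proof. by apply: measurable_funB => //; exact: measurable_snd. Qed.

Lemma measurable_circle c r : measurable (circle c r : set plane).
Proof.
rewrite [circle c r](_ : _ = (fun y : R * R => enorm (y - c)) @^-1` [set r]); last by [].
rewrite -[X in measurable X]setTI.
apply: (measurable_enorm (measurable_shift1 c) (measurable_shift2 c)) => //.
Qed.

Lemma arclength_setT c r : 0 <= r -> arclength c r setT = (2 * pi * r)%:E.
Proof.
move=> r0; rewrite /arclength /pushforward preimage_setT /= /mrestr setTI.
rewrite lebesgue_measure_itv /= lte_fin.
have [_|] := ltP; first by rewrite -EFinB subr0.
move=> h; congr (_%:E); apply/esym/eqP; rewrite eq_le h.
by rewrite mulr_ge0// mulr_ge0// pi_ge0.
Qed.

Lemma arclength_lty c r : (arclength c r setT < +oo)%E.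
Proof.
rewrite /arclength /pushforward preimage_setT /= /mrestr setTI.
by rewrite lebesgue_measure_itv /=; case: ifP => _; rewrite ?ltry.
Qed.

Lemma arclength_fin c r : fin_num_fun (arclength c r).
Proof. by apply: lty_fin_num_fun; exact: arclength_lty. Qed.

HB.instance Definition _ c r := Measure_isFinite.Build _ _ _ (arclength c r)
  (@arclength_fin c r).

Lemma arclength_circleC c r : 0 <= r -> arclength c r (~` circle c r) = 0%E.
Proof.
move=> r0; rewrite /arclength /pushforward /= /mrestr.
rewrite (_ : _ @^-1` _ = set0) ?set0I ?measure0//.
by rewrite -subset0 => s /=; apply; exact: arc_param_circle.
Qed.

(** The parametrization never leaves the circle, so its complement is a null set. This transfers
    pointwise facts on the circle to integrals over the plane. *)
Lemma ae_circle c r (P : plane -> Prop) : 0 <= r ->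
  (forall y, circle c r y -> P y) -> {ae arclength c r, forall y, P y}.
Proof.
move=> r0 cP; exists (~` circle c r); split.
- by apply: measurableC; exact: measurable_circle.
- exact: arclength_circleC.
- by move=> y /=; exact: contra_not (@cP y).
Qed.

Lemma integrable_bounded_circle c r (f : plane -> R) M : 0 <= r ->
  measurable_fun setT f -> (forall y, circle c r y -> `|f y| <= M) ->
  (arclength c r).-integrable setT (EFin \o f).
Proof.
move=> r0 mf fM; apply: (@ae_integrable _ _ _ _ _ (cst M)) => //.
  exact: ae_circle.
by apply: finite_measure_integrable_cst.
Qed.

Lemma eq_circle_Rintegral c r (f g : plane -> R) : 0 <= r ->
  measurable_fun setT f -> measurable_fun setT g ->
  (forall y, circle c r y -> f y = g y) ->
  \int[arclength c r]_y f y = \int[arclength c r]_y g y.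
Proof. by move=> r0 mf mg fg; apply: eq_ae_Rintegral => //; exact: ae_circle. Qed.

(** The half-open parameter interval is closed up here, in order to apply the fundamental theorem of
    calculus. *)
Lemma Rintegral_arclength c r (f : plane -> R) :
  (arclength c r).-integrable setT (EFin \o f) ->
  \int[arclength c r]_y f y =
  \int[@lebesgue_measure R]_(s in `[0, 2 * pi * r]) f (arc_param c r s).
Proof.
move=> intf; have /integrableP[mf fty] := intf.
pose D : set (measurableTypeR R) := `[0, 2 * pi * r[%classic.
pose mu := mrestr (@lebesgue_measure R) (measurable_itv `[0, 2 * pi * r[ : measurable D).
have mD : measurable D by exact: measurable_itv.
have mfa : measurable_fun setT ((EFin \o f) \o arc_param c r).
  by apply: measurableT_comp => //; exact: measurable_arc_param.
have intfa : mu.-integrable setT ((EFin \o f) \o arc_param c r).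
  apply/integrableP; split => //.
  move: fty; rewrite ge0_integral_pushforward//; last first.
    by apply: measurableT_comp.
have muD : mu (~` D) = 0%E by rewrite /mu /mrestr setICl measure0.
rewrite /Rintegral integral_pushforward//= preimage_setT.
rewrite (negligible_integral (N := ~` D) _ _ intfa)//; last exact: measurableC.
rewrite setTD setCK (@eq_measure_integral _ _ _ D (@lebesgue_measure R)); last first.
  by move=> A mA AD; rewrite /= /mrestr setIidl.
rewrite -integral_itv_bndo_bndc//.
exact: measurable_funTS.
Qed.

Lemma Rintegral_arclength_cst c r (k : R) : 0 <= r ->
  \int[arclength c r]_y k = 2 * pi * r * k.
Proof.
move=> r0; rewrite Rintegral_cst// mulrC; congr (_ * _).
by rewrite [X in fine X](arclength_setT c r0).
Qed.

End CircleMeasure.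

(** * The plane as the complex line *)

Section ComplexFunctions.
Variable R : realType.
Implicit Types (c : R * R) (r : R) (f g : R * R -> R[i]).
Local Notation plane := (measurableTypeR R * measurableTypeR R)%type.

Definition toC (x : R * R) : R[i] := x.1 +i* x.2.

Lemma toCD x y : toC (x + y) = toC x + toC y. Proof. by []. Qed.
Lemma toCN x : toC (- x) = - toC x. Proof. by []. Qed.
Lemma toCB x y : toC (x - y) = toC x - toC y. Proof. by []. Qed.

Lemma normc_toC x : normc (toC x) = enorm x.
Proof. by rewrite /enorm /dot /= -!expr2. Qed.

Lemma normcR (a : R) : normc a%:C = `|a|.
Proof. by rewrite /= expr0n /= addr0 sqrtr_sqr. Qed.

Lemma normc_ge0 (z : R[i]) : 0 <= normc z.
Proof. by case: z => a b; exact: sqrtr_ge0. Qed.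

Lemma normc_eq0 (z : R[i]) : (normc z == 0) = (z == 0).
Proof.
apply/eqP/eqP => [/ComplexField.Normc.eq0_normc//|->].
exact: ComplexField.Normc.normc0.
Qed.

Lemma normcX (z : R[i]) n : normc (z ^+ n) = normc z ^+ n.
Proof.
elim: n => [|n IH]; first by rewrite !expr0 ComplexField.Normc.normc1.
by rewrite !exprS ComplexField.Normc.normcM IH.
Qed.

Lemma Re_le_normc (z : R[i]) : `|complex.Re z| <= normc z.
Proof.
case: z => a b /=; rewrite -[leLHS]sqrtr_sqr ler_sqrt ?addr_ge0 ?sqr_ge0//.
by rewrite lerDl sqr_ge0.
Qed.

Lemma Im_le_normc (z : R[i]) : `|complex.Im z| <= normc z.
Proof.
case: z => a b /=; rewrite -[leLHS]sqrtr_sqr ler_sqrt ?addr_ge0 ?sqr_ge0//.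
by rewrite lerDr sqr_ge0.
Qed.

Lemma normc_le_ReIm (z : R[i]) : normc z <= `|complex.Re z| + `|complex.Im z|.
Proof.
case: z => a b /=; have h : 0 <= `|a| + `|b| by rewrite addr_ge0.
rewrite -[leRHS](ger0_norm h) -sqrtr_sqr ler_sqrt ?sqr_ge0// sqrrD.
by rewrite !real_normK ?num_real// lerD2r lerDl mulrn_wge0// mulr_ge0.
Qed.

Lemma mulc_conj (z : R[i]) : z * conjc z = (normc z ^+ 2)%:C.
Proof.
case: z => a b; rewrite /= sqr_sqrtr ?addr_ge0 ?sqr_ge0//.
by apply/eqP; rewrite eq_complex /=; apply/andP; split; apply/eqP; ring.
Qed.

(* Normalized by [enorm (y - c)] rather than by the radius, so that functions of
   [dir c] are bounded on the whole plane; the value at [c] is [0 / 0 = 0]. *)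
Definition dir c (y : R * R) : R[i] := toC (y - c) / (enorm (y - c))%:C.

Lemma dir_le1 c y : normc (dir c y) <= 1.
Proof.
rewrite ComplexField.Normc.normcM ComplexField.Normc.normcV normc_toC normcR.
rewrite ger0_norm; last exact: sqrtr_ge0.
by have [->|?] := eqVneq (enorm (y - c)) 0; rewrite ?mul0r// divff.
Qed.

Lemma dir_circle c r y : circle c r y -> dir c y = toC (y - c) / r%:C.
Proof. by rewrite /dir => ->. Qed.

Lemma dir_conj c r y : 0 < r -> circle c r y -> dir c y * conjc (dir c y) = 1.
Proof.
move=> r0 cy; rewrite mulc_conj (dir_circle cy).
rewrite ComplexField.Normc.normcM ComplexField.Normc.normcV normc_toC normcR.
by rewrite cy gtr0_norm// divff ?gt_eqF// expr1n.
Qed.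

Definition cmeasurable f : Prop :=
  measurable_fun [set: plane] (fun y => complex.Re (f y)) /\
  measurable_fun [set: plane] (fun y => complex.Im (f y)).

Lemma cmeasurable_cst a : cmeasurable (cst a).
Proof. by split; exact: measurable_cst. Qed.

Lemma cmeasurableD f g : cmeasurable f -> cmeasurable g ->
  cmeasurable (fun y => f y + g y).
Proof.
move=> [f1 f2] [g1 g2]; split.
- rewrite (_ : (fun _ => _) = (fun y => complex.Re (f y) + complex.Re (g y))).
    exact: measurable_funD.
  by apply/funext => y; case: (f y) (g y) => ? ? [].
- rewrite (_ : (fun _ => _) = (fun y => complex.Im (f y) + complex.Im (g y))).
    exact: measurable_funD.
  by apply/funext => y; case: (f y) (g y) => ? ? [].
Qed.

Lemma cmeasurableM f g : cmeasurable f -> cmeasurable g ->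
  cmeasurable (fun y => f y * g y).
Proof.
move=> [f1 f2] [g1 g2]; split.
- rewrite (_ : (fun _ => _) = (fun y => complex.Re (f y) * complex.Re (g y)
      - complex.Im (f y) * complex.Im (g y))).
    by apply: measurable_funB; exact: measurable_funM.
  by apply/funext => y; case: (f y) (g y) => ? ? [].
- rewrite (_ : (fun _ => _) = (fun y => complex.Re (f y) * complex.Im (g y)
      + complex.Im (f y) * complex.Re (g y))).
    by apply: measurable_funD; exact: measurable_funM.
  by apply/funext => y; case: (f y) (g y) => ? ? [].
Qed.

Lemma cmeasurableX f n : cmeasurable f -> cmeasurable (fun y => f y ^+ n).
Proof.
move=> mf; elim: n => [|n IH]; first exact: (cmeasurable_cst 1).
by under [X in cmeasurable X]funext do rewrite exprS; exact: cmeasurableM.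
Qed.

Lemma cmeasurable_conj f : cmeasurable f -> cmeasurable (fun y => conjc (f y)).
Proof.
move=> [f1 f2]; split.
- by rewrite (_ : (fun _ => _) = (fun y => complex.Re (f y)))//; apply/funext => y; case: (f y).
- rewrite (_ : (fun _ => _) = (fun y => - complex.Im (f y))).
    exact: measurable_funN.
  by apply/funext => y; case: (f y).
Qed.

Lemma cmeasurableV f : cmeasurable f -> cmeasurable (fun y => (f y)^-1).
Proof.
move=> [f1 f2]; have m2 : measurable_fun [set: plane]
    (fun y => (complex.Re (f y) ^+ 2 + complex.Im (f y) ^+ 2)^-1).
  by apply: measurable_funV; apply: measurable_funD; exact: measurable_funX.
split.
- rewrite (_ : (fun _ => _) = (fun y => complex.Re (f y) *
      (complex.Re (f y) ^+ 2 + complex.Im (f y) ^+ 2)^-1)).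
    exact: measurable_funM.
  by apply/funext => y; case: (f y).
- rewrite (_ : (fun _ => _) = (fun y => - (complex.Im (f y) *
      (complex.Re (f y) ^+ 2 + complex.Im (f y) ^+ 2)^-1))).
    by apply: measurable_funN; exact: measurable_funM.
  by apply/funext => y; case: (f y).
Qed.

Lemma cmeasurable_real (u : plane -> R) : measurable_fun setT u ->
  cmeasurable (fun y => (u y)%:C).
Proof. by move=> mu; split => //; exact: measurable_cst. Qed.

Lemma cmeasurable_dir c : cmeasurable (dir c).
Proof.
apply: cmeasurableM.
  split; [exact: measurable_shift1|exact: measurable_shift2].
apply: cmeasurableV; apply: cmeasurable_real.
by apply: measurable_enorm; [exact: measurable_shift1|exact: measurable_shift2].
Qed.

End ComplexFunctions.

(** * Circle averages of analytic functions *)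

Section CircleAverages.
Variable R : realType.
Implicit Types (c : R * R) (r : R) (f g : R * R -> R[i]).
Local Notation plane := (measurableTypeR R * measurableTypeR R)%type.

(** Boundedness is required on the whole plane, not only on one circle: the class is then closed
    under sums and products, and integrable on every circle at once. *)
Definition bmeas f : Prop := cmeasurable f /\ exists M, forall y, normc (f y) <= M.

Lemma bmeas_cst a : bmeas (cst a).
Proof. by split; [exact: cmeasurable_cst|exists (normc a)]. Qed.

Lemma bmeasD f g : bmeas f -> bmeas g -> bmeas (fun y => f y + g y).
Proof.
move=> [mf [M fM]] [mg [N gN]]; split; first exact: cmeasurableD.
by exists (M + N) => y; rewrite (le_trans (le_normcD _ _))// lerD.
Qed.

Lemma bmeasM f g : bmeas f -> bmeas g -> bmeas (fun y => f y * g y).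
Proof.
move=> [mf [M fM]] [mg [N gN]]; split; first exact: cmeasurableM.
exists (M * N) => y; rewrite ComplexField.Normc.normcM ler_pM ?normc_ge0//.
Qed.

Lemma bmeasZ a f : bmeas f -> bmeas (fun y => a * f y).
Proof. by move=> bf; apply: bmeasM => //; exact: bmeas_cst. Qed.

Lemma bmeasX f n : bmeas f -> bmeas (fun y => f y ^+ n).
Proof.
move=> [mf [M fM]]; split; first exact: cmeasurableX.
by exists (M ^+ n) => y; rewrite normcX lerXn2r ?nnegrE ?normc_ge0// (le_trans (normc_ge0 _) (fM y)).
Qed.

Lemma normcJ (z : R[i]) : normc (conjc z) = normc z.
Proof. by case: z => a b /=; rewrite sqrrN. Qed.

Lemma bmeas_conj f : bmeas f -> bmeas (fun y => conjc (f y)).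
Proof.
move=> [mf [M fM]]; split; first exact: cmeasurable_conj.
by exists M => y; rewrite normcJ.
Qed.

Lemma bmeas_dir c : bmeas (dir c).
Proof. by split; [exact: cmeasurable_dir|exists 1 => y; exact: dir_le1]. Qed.

Lemma bmeas_integrable_Re c r f : bmeas f ->
  (arclength c r).-integrable setT (EFin \o (fun y => complex.Re (f y))).
Proof.
move=> [[mf _] [M fM]]; apply: (@ae_integrable _ _ _ _ _ (cst M)) => //.
  by apply: aeW => y; exact: le_trans (Re_le_normc _) _.
exact: finite_measure_integrable_cst.
Qed.

Lemma bmeas_integrable_Im c r f : bmeas f ->
  (arclength c r).-integrable setT (EFin \o (fun y => complex.Im (f y))).
Proof.
move=> [[_ mf] [M fM]]; apply: (@ae_integrable _ _ _ _ _ (cst M)) => //.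
  by apply: aeW => y; exact: le_trans (Im_le_normc _) _.
exact: finite_measure_integrable_cst.
Qed.

Lemma bintD c r f g : bmeas f -> bmeas g ->
  bint c r (fun y => f y + g y) = bint c r f + bint c r g.
Proof.
move=> bf bg; rewrite /bint; congr Complex.
- rewrite -RintegralD//; [|exact: bmeas_integrable_Re..].
  by apply: eq_Rintegral => y _; case: (f y) (g y) => ? ? [].
- rewrite -RintegralD//; [|exact: bmeas_integrable_Im..].
  by apply: eq_Rintegral => y _; case: (f y) (g y) => ? ? [].
Qed.

Lemma bintZ c r a f : bmeas f -> bint c r (fun y => a * f y) = a * bint c r f.
Proof.
move=> bf; have iR := bmeas_integrable_Re c r bf.
have iI := bmeas_integrable_Im c r bf.
have iZ (k : R) h : (arclength c r).-integrable setT (EFin \o h) ->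
  (arclength c r).-integrable setT (EFin \o (fun y => k * h y)).
  by move=> ih; apply: (integrableZl _ k ih).
case: a => a b; rewrite /bint; apply/eqP; rewrite eq_complex /=; apply/andP; split; apply/eqP.
- rewrite -!RintegralZl// -RintegralB//; [|exact: iZ..].
  by apply: eq_Rintegral => y _; case: (f y).
- rewrite -!RintegralZl// -RintegralD//; [|exact: iZ..].
  by apply: eq_Rintegral => y _; case: (f y).
Qed.

Lemma bint_conj c r f : bmeas f ->
  bint c r (fun y => conjc (f y)) = conjc (bint c r f).
Proof.
move=> bf; have iI := bmeas_integrable_Im c r bf.
rewrite /bint; apply/eqP; rewrite eq_complex /=; apply/andP; split; apply/eqP.
- by apply: eq_Rintegral => y _; case: (f y).
- rewrite -mulN1r -RintegralZl//.
  by apply: eq_Rintegral => y _; case: (f y) => ? ?; rewrite mulN1r.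
Qed.

Lemma eq_circle_bint c r f g : 0 <= r -> cmeasurable f -> cmeasurable g ->
  (forall y, circle c r y -> f y = g y) -> bint c r f = bint c r g.
Proof.
move=> r0 [f1 f2] [g1 g2] fg; rewrite /bint; congr Complex.
- by apply: eq_circle_Rintegral => // y /fg ->.
- by apply: eq_circle_Rintegral => // y /fg ->.
Qed.

Lemma bint_cst c r a : 0 <= r -> bint c r (cst a) = (2 * pi * r)%:C * a.
Proof.
move=> r0; rewrite /bint !Rintegral_arclength_cst//.
by case: a => a b; apply/eqP; rewrite eq_complex /=; apply/andP; split; apply/eqP; ring.
Qed.

(** The constant is twice the length of the circle, as real and imaginary parts are estimated
    separately; only geometric decay matters where it is applied. *)
Lemma normc_bint_le c r f M : 0 <= r -> cmeasurable f ->
  (forall y, normc (f y) <= M) -> normc (bint c r f) <= 4 * pi * r * M.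
Proof.
move=> r0 mf fM; have bf : bmeas f by split => //; exists M.
have key h : (arclength c r).-integrable setT (EFin \o h) ->
    (forall y, `|h y| <= M) -> `|\int[arclength c r]_y h y| <= M * (2 * pi * r).
  move=> ih hM; rewrite (le_trans (le_normr_Rintegral _ ih))//.
  rewrite (_ : _ * _ = \int[arclength c r]_y (cst M y)); last first.
    by rewrite Rintegral_arclength_cst// mulrC.
  apply: le_Rintegral => //; last exact: finite_measure_integrable_cst.
  exact: integrable_norm ih.
apply: le_trans (normc_le_ReIm _) _.
rewrite (_ : 4 * pi * r * M = M * (2 * pi * r) + M * (2 * pi * r)); last by ring.
by apply: lerD; apply: key => [|y];
  [exact: bmeas_integrable_Re|exact: le_trans (Re_le_normc _) _|
   exact: bmeas_integrable_Im|exact: le_trans (Im_le_normc _) _].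
Qed.

Lemma circle_arc_param c r s : 0 <= r -> circle c r (arc_param c r s).
Proof. exact: arc_param_circle. Qed.

Lemma dir_arc_param c r s : 0 < r ->
  dir c (arc_param c r s) = cos (s / r) +i* sin (s / r).
Proof.
move=> r0; rewrite (dir_circle (circle_arc_param _ _ (ltW r0))).
rewrite (_ : toC _ = r%:C * (cos (s / r) +i* sin (s / r))); last first.
  apply/eqP; rewrite eq_complex /=; apply/andP; split; apply/eqP.
  - by rewrite mul0r subr0 addrC addKr.
  - by rewrite mul0r addr0 addrC addKr.
rewrite mulrAC divff ?mul1r//.
by apply/eqP => -[] /eqP; rewrite gt_eqF.
Qed.

Lemma de_Moivre (t : R) n : (cos t +i* sin t) ^+ n = cos (n%:R * t) +i* sin (n%:R * t).
Proof.
elim: n => [|n IH]; first by rewrite expr0 mul0r cos0 sin0.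
rewrite exprS IH -natr1 mulrDl mul1r cosD sinD.
by apply/eqP; rewrite eq_complex /=; apply/andP; split; apply/eqP; ring.
Qed.

Lemma Rintegral_derive (F f : R -> R) (a b : R) : a < b -> continuous f ->
  (forall x : R, is_derive x 1 F (f x)) ->
  \int[@lebesgue_measure R]_(x in `[a, b]) f x = F b - F a.
Proof.
move=> ab cf dF; have cF (x : R) : {for x, continuous F}.
  by apply: differentiable_continuous; apply/derivable1_diffP; case: (dF x).
rewrite /Rintegral (@continuous_FTC2 _ _ F)//.
- by apply: continuous_in_subspaceT => x ?; exact: cf.
- split.
  + by move=> x _; case: (dF x).
  + by apply: cvg_at_right_filter; exact: cF.
  + by apply: cvg_at_left_filter; exact: cF.
- by move=> x _; rewrite derive1E; exact: derive_val.
Qed.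

(** By de Moivre the integrand is cos (k s) + i sin (k s) in arc length, with k = (n + 1) / r, and
    its primitive is periodic over the length 2 pi r. Apart from constants, this is the only circle
    integral computed by calculus. *)
Lemma bint_dirX c r n : 0 < r -> bint c r (fun y => dir c y ^+ n.+1) = 0.
Proof.
move=> r0; have bd := bmeasX n.+1 (bmeas_dir c).
rewrite /bint (Rintegral_arclength (bmeas_integrable_Re c r bd)).
rewrite (Rintegral_arclength (bmeas_integrable_Im c r bd)).
have T0 : 0 < 2 * pi * r by rewrite !mulr_gt0// pi_gt0.
pose k := n.+1%:R / r.
have k0 : k != 0 by rewrite mulf_neq0 ?invr_eq0 ?pnatr_eq0 ?gt_eqF.
have kT : k * (2 * pi * r) = 2 * pi *+ n.+1.
  by rewrite /k -mulrA [2 * pi * r]mulrC mulKf ?gt_eqF// mulr_natl.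
have kE s : n.+1%:R * (s / r) = s * k by rewrite /k mulrCA.
have dirE s : dir c (arc_param c r s) ^+ n.+1 = cos (s * k) +i* sin (s * k).
  by rewrite dir_arc_param// de_Moivre kE.
under eq_Rintegral do rewrite dirE /=.
under [X in _ +i* X]eq_Rintegral do rewrite dirE /=.
have dk (s : R) : is_derive s 1 (fun t : R => t * k) k.
  by apply: is_derive_eq; rewrite scaler0 add0r scaler1.
have ck : continuous (fun t : R => t * k).
  by move=> s; apply: differentiable_continuous; apply/derivable1_diffP; case: (dk s).
have dS (s : R) : is_derive s 1 (fun t => sin (t * k) / k) (cos (s * k)).
  have h : is_derive s 1 (sin \o (fun t : R => t * k)) (cos (s * k) * k).
    exact: is_derive1_comp.
  by apply: is_derive_eq; rewrite scaler0 add0r /GRing.scale/= mulrC mulfK.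
have dC (s : R) : is_derive s 1 (fun t => - (cos (t * k) / k)) (sin (s * k)).
  have h : is_derive s 1 (cos \o (fun t : R => t * k)) (- sin (s * k) * k).
    exact: is_derive1_comp.
  by apply: is_derive_eq; rewrite scaler0 add0r /GRing.scale/= mulrC mulfK// opprK.
have cosT : cos (2 * pi * r * k) = 1.
  rewrite mulrC kT mulr_natl -[X in cos X]add0r periodicn ?cos0//.
  exact: cosD2pi.
have sinT : sin (2 * pi * r * k) = 0.
  rewrite mulrC kT mulr_natl -[X in sin X]add0r periodicn ?sin0//.
  exact: sinD2pi.
rewrite (Rintegral_derive T0 _ dS); last first.
  by move=> s; apply: continuous_comp (ck s) _; exact: continuous_cos.
rewrite (Rintegral_derive T0 _ dC); last first.
  by move=> s; apply: continuous_comp (ck s) _; exact: continuous_sin.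
by rewrite cosT sinT !mul0r sin0 cos0 mul0r !subrr.
Qed.

End CircleAverages.

(** * Boundary values of analytic functions *)

Section Hardy.
Variable R : realType.
Implicit Types (c : R * R) (r : R) (f g G : R * R -> R[i]) (a q : R[i]).

Lemma geometric_bound0 (x q K : R) : 0 <= x -> 0 <= q -> q < 1 ->
  (forall N, x <= q ^+ N * K) -> x = 0.
Proof.
move=> x0 q0 q1 xN; apply/eqP; rewrite eq_le x0 andbT.
have h : (fun N => q ^+ N * K) @ \oo --> 0 * K.
  by apply: cvgMl; apply: cvg_expr; rewrite ger0_norm.
rewrite mul0r in h; rewrite -(cvg_lim _ h)//; apply: limr_ge.
  by apply/cvg_ex; exists 0.
exact: nearW.
Qed.

Lemma conjcM (a b : R[i]) : conjc (a * b) = conjc a * conjc b.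
Proof. exact: rmorphM. Qed.

Lemma conjcX (a : R[i]) n : conjc (a ^+ n) = conjc a ^+ n.
Proof. exact: rmorphXn. Qed.

(** The boundary value of 1 / (1 - a z), analytic in the disk when |a| < 1. Both kernels and dipoles
    are built from it. *)
Definition geo c a y : R[i] := (1 - a * dir c y)^-1.

Lemma normc_geo_den c a y : normc a < 1 -> 1 - normc a <= normc (1 - a * dir c y).
Proof.
move=> a1; have := le_normcD (1 - a * dir c y) (a * dir c y).
rewrite subrK ComplexField.Normc.normc1 ComplexField.Normc.normcM => h.
rewrite lerBlDr (le_trans h)// lerD2l ler_piMr ?normc_ge0//; exact: dir_le1.
Qed.

Lemma geo_den_neq0 c a y : normc a < 1 -> 1 - a * dir c y != 0.
Proof.
move=> a1; rewrite -normc_eq0 gt_eqF// (lt_le_trans _ (normc_geo_den c y a1))//.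
by rewrite subr_gt0.
Qed.

Lemma normc_geo c a y : normc a < 1 -> normc (geo c a y) <= (1 - normc a)^-1.
Proof.
move=> a1; rewrite ComplexField.Normc.normcV lef_pV2 ?normc_geo_den ?posrE ?subr_gt0//.
by rewrite (lt_le_trans _ (normc_geo_den c y a1))// subr_gt0.
Qed.

Lemma geoE c a y : normc a < 1 -> geo c a y = 1 + a * (dir c y * geo c a y).
Proof. by move=> a1; have := geo_den_neq0 c y a1; rewrite /geo => h; field. Qed.

Lemma bmeas_geo c a : normc a < 1 -> bmeas (geo c a).
Proof.
move=> a1; split; last by exists (1 - normc a)^-1 => y; exact: normc_geo.
apply: cmeasurableV; apply: (cmeasurableD (cmeasurable_cst 1)).
under [X in cmeasurable X]funext do rewrite -mulNr.
by apply: (cmeasurableM (cmeasurable_cst _)); exact: cmeasurable_dir.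
Qed.

(* Boundary values of analytic functions on the disk. *)
Definition hardy c r G : Prop :=
  bmeas G /\ forall n, bint c r (fun y => dir c y ^+ n.+1 * G y) = 0.

Lemma hardy1 c r : 0 < r -> hardy c r (cst 1).
Proof.
move=> r0; split; first exact: bmeas_cst.
by move=> n; under [X in bint _ _ X]funext do rewrite mulr1; exact: bint_dirX.
Qed.

(* Everything follows from [geo = 1 + a * dir * geo], iterated using [|a| < 1]. *)
Lemma bint_geo_rec c r a G n : 0 < r -> normc a < 1 -> bmeas G ->
  bint c r (fun y => dir c y ^+ n * (geo c a y * G y)) =
  bint c r (fun y => dir c y ^+ n * G y) +
  a * bint c r (fun y => dir c y ^+ n.+1 * (geo c a y * G y)).
Proof.
move=> r0 a1 bG; have bd m := bmeasX m (bmeas_dir c); have bg := bmeas_geo c a1.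
rewrite -bintZ; last by do 2?apply: bmeasM.
rewrite -bintD; [|by do 2?apply: bmeasM|by apply: bmeasZ; do 2?apply: bmeasM].
congr bint; apply/funext => y; rewrite exprS.
by rewrite {1}(geoE c y a1); ring.
Qed.

(** The moments satisfy I m = a * I (m + 1) because those of [G] vanish; iterating, each is a^N
    times a quantity bounded independently of N, hence 0. No power series has to be integrated term
    by term. *)
Lemma hardy_geo c r a G : 0 < r -> normc a < 1 -> hardy c r G ->
  hardy c r (fun y => geo c a y * G y).
Proof.
move=> r0 a1 [bG hG]; have bgG := bmeasM (bmeas_geo c a1) bG.
split => // n; set I := fun n => bint c r (fun y => dir c y ^+ n * (geo c a y * G y)).
have IS m : I m.+1 = a * I m.+2 by rewrite /I bint_geo_rec// hG add0r.
have IN N m : I m.+1 = a ^+ N * I (m + N).+1.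
  elim: N => [|N IH]; first by rewrite expr0 mul1r addn0.
  by rewrite IH IS mulrA -exprSr addnS.
have [mgG [M gM]] := bgG.
apply/eqP; rewrite -normc_eq0; apply/eqP.
apply: (@geometric_bound0 _ (normc a) (4 * pi * r * M)); rewrite ?normc_ge0// => N.
rewrite -/(I n.+1) (IN N) ComplexField.Normc.normcM normcX.
apply: ler_wpM2l; first by rewrite exprn_ge0// normc_ge0.
apply: normc_bint_le (ltW r0) _ _.
  by apply: cmeasurableM => //; apply: cmeasurableX; exact: cmeasurable_dir.
move=> y; rewrite ComplexField.Normc.normcM normcX.
rewrite -[leRHS]mul1r ler_pM ?exprn_ge0 ?normc_ge0//.
by rewrite exprn_ile1 ?normc_ge0//; exact: dir_le1.
Qed.

(** Mean value property: the factor 1 / (1 - a z) equals 1 at the center. *)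
Lemma bint_geo c r a G : 0 < r -> normc a < 1 -> hardy c r G ->
  bint c r (fun y => geo c a y * G y) = bint c r G.
Proof.
move=> r0 a1 hG; have [bG _] := hG.
have := bint_geo_rec c 0 r0 a1 bG.
rewrite (hardy_geo r0 a1 hG).2 mulr0 addr0.
do 2?under [X in bint _ _ X]funext do rewrite expr0 mul1r.
by under [X in _ = bint _ _ X -> _]funext do rewrite expr0 mul1r.
Qed.

(** This is z f'(z) for f(z) = z / (1 - a z), so its real part is the normal derivative on the
    circle of Re (r f). The simple pole of f at z = 1 / a is the dipole, and a = 0 is the uniform
    field. *)
Definition dipole c a y : R[i] := dir c y * geo c a y ^+ 2.

Lemma bmeas_dipole c a : normc a < 1 -> bmeas (dipole c a).
Proof.
move=> a1; apply: bmeasM (bmeas_dir c) _; apply: bmeasX; exact: bmeas_geo.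
Qed.

Lemma hardy_geo2 c r a : 0 < r -> normc a < 1 -> hardy c r (fun y => geo c a y ^+ 2).
Proof.
move=> r0 a1.
rewrite (_ : (fun _ => _) = (fun y => geo c a y * (geo c a y * 1))); last first.
  by apply/funext => y; rewrite mulr1 expr2.
by do 2?apply: hardy_geo => //; exact: hardy1.
Qed.

Lemma bint_geo2 c r a : 0 < r -> normc a < 1 ->
  bint c r (fun y => geo c a y ^+ 2) = (2 * pi * r)%:C.
Proof.
move=> r0 a1; have h1 := hardy1 c r0.
rewrite (_ : (fun _ => _) = (fun y => geo c a y * (geo c a y * 1))); last first.
  by apply/funext => y; rewrite mulr1 expr2.
rewrite bint_geo//; last exact: hardy_geo.
by rewrite (bint_geo _ _ h1)// bint_cst ?mulr1// ltW.
Qed.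

Lemma bint_dipole c r a : 0 < r -> normc a < 1 -> bint c r (dipole c a) = 0.
Proof. by move=> r0 a1; exact: (hardy_geo2 c r0 a1).2 0. Qed.

Lemma bint_dir_dipole c r a : 0 < r -> normc a < 1 ->
  bint c r (fun y => dir c y * dipole c a y) = 0.
Proof.
move=> r0 a1; rewrite -[RHS]((hardy_geo2 c r0 a1).2 1); congr bint.
by apply/funext => y; rewrite /dipole mulrA -expr2.
Qed.

Lemma bint_conj_dir_dipole c r a : 0 < r -> normc a < 1 ->
  bint c r (fun y => conjc (dir c y) * dipole c a y) = (2 * pi * r)%:C.
Proof.
move=> r0 a1; rewrite -(bint_geo2 c r0 a1).
have [md _] := bmeas_dir c; have [mD _] := bmeas_dipole c a1.
have [mg _] := hardy_geo2 c r0 a1.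
apply: eq_circle_bint => [|||y cy]; rewrite ?ltW//.
- by apply: cmeasurableM => //; exact: cmeasurable_conj.
- by case: mg.
- by rewrite /dipole mulrA [conjc _ * _]mulrC (dir_conj r0 cy) mul1r.
Qed.

(** The product is analytic and vanishes at the center. *)
Lemma bint_geo_dipole c r a q : 0 < r -> normc a < 1 -> normc q < 1 ->
  bint c r (fun y => geo c a y * dipole c q y) = 0.
Proof.
move=> r0 a1 q1; have h := hardy_geo r0 a1 (hardy_geo2 c r0 q1).
rewrite -[RHS](h.2 0); congr bint; apply/funext => y.
by rewrite /dipole expr1 mulrCA.
Qed.

Lemma normc_lt1_den a q : normc a < 1 -> normc q < 1 -> 1 - a * conjc q != 0.
Proof.
move=> a1 q1; rewrite subr_eq0; apply: contraTN isT => /eqP h.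
have := ComplexField.Normc.normc1 R; rewrite h ComplexField.Normc.normcM normcJ.
by move/eqP; rewrite lt_eqF// mulr_ilt1 ?normc_ge0.
Qed.

(** The product of an analytic and an antianalytic factor is split by partial fractions, using that
    z and its conjugate are inverse on the circle; each piece then has a known mean. *)
Lemma bint_geo_conj_dipole c r a q : 0 < r -> normc a < 1 -> normc q < 1 ->
  bint c r (fun y => geo c a y * conjc (dipole c q y)) =
  (2 * pi * r)%:C * (a / (1 - a * conjc q) ^+ 2).
Proof.
move=> r0 a1 q1; set d := 1 - a * conjc q; have d0 : d != 0 := normc_lt1_den a1 q1.
have bga := bmeas_geo c a1; have bgq := bmeas_conj (bmeas_geo c q1).
have bgq2 : bmeas (fun y => conjc (geo c q y) ^+ 2) by apply: bmeasX.
have bD := bmeas_conj (bmeas_dipole c q1).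
have h1 := hardy1 c r0.
have I1 b : normc b < 1 -> bint c r (geo c b) = (2 * pi * r)%:C.
  move=> b1; rewrite -[RHS]mulr1 -(bint_cst c 1 (ltW r0)) -(bint_geo r0 b1 h1).
  by congr bint; apply/funext => y; rewrite mulr1.
have Iq : bint c r (fun y => conjc (geo c q y)) = (2 * pi * r)%:C.
  by rewrite bint_conj ?I1 ?conjc_real//; exact: bmeas_geo.
have Iq2 : bint c r (fun y => conjc (geo c q y) ^+ 2) = (2 * pi * r)%:C.
  rewrite (_ : (fun _ => _) = (fun y => conjc (geo c q y ^+ 2))); last first.
    by apply/funext => y; rewrite rmorphXn.
  by rewrite bint_conj ?bint_geo2 ?conjc_real//; apply: bmeasX; exact: bmeas_geo.
(* Partial fractions in z, the term -1 correcting the constant that both summands contain. *)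
have key y : circle c r y -> geo c a y * conjc (geo c q y) =
    d^-1 * (geo c a y + (conjc (geo c q y) + - 1)).
  move=> cy; have := geo_den_neq0 c y a1; have := geo_den_neq0 c y q1.
  have := dir_conj r0 cy; rewrite /geo; move: (dir c y) => z zz.
  rewrite -conjc_eq0 conjc_inv !rmorphB !rmorphM !rmorph1 /=.
  move: d0; rewrite /d; move: (conjc q) zz; move: (conjc z) => zb qb zz d0 zb0 z0.
  apply: (mulfI d0); rewrite mulVKf//.
  have -> : 1 - a * qb = 1 - a * qb * (z * zb) by rewrite zz mulr1.
  by field; rewrite zb0 z0.
have bgg : bmeas (fun y => geo c a y * conjc (geo c q y)) by apply: bmeasM.
have bN1 : bmeas (cst (- 1) : R * R -> R[i]) by apply: bmeas_cst.
have I11 : bint c r (fun y => geo c a y * conjc (geo c q y)) = (2 * pi * r)%:C / d.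
  rewrite (eq_circle_bint (ltW r0) bgg.1 _ key); last first.
    by apply: cmeasurableM; [exact: cmeasurable_cst|apply: (bmeasD _ _).1 => //; exact: bmeasD].
  rewrite bintZ; last by apply: bmeasD => //; apply: bmeasD.
  rewrite bintD//; last exact: bmeasD.
  rewrite bintD// I1// Iq bint_cst ?ltW// mulrN1 subrr addr0 mulrC//.
have bggg : bmeas (fun y => geo c a y * conjc (geo c q y) ^+ 2) by apply: bmeasM.
have bBN : bmeas (fun y => conjc (geo c q y) ^+ 2 + -1 * conjc (geo c q y)).
  by apply: bmeasD => //; exact: bmeasZ.
(* Multiplying [key] by one more conjugate factor reduces the square to the integral [I11]. *)
have I12 : bint c r (fun y => geo c a y * conjc (geo c q y) ^+ 2) = (2 * pi * r)%:C / d ^+ 2.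
  rewrite (@eq_circle_bint _ _ _ _ (fun y => d^-1 * (geo c a y * conjc (geo c q y) +
      (conjc (geo c q y) ^+ 2 + -1 * conjc (geo c q y)))) (ltW r0) bggg.1); first last.
  - by move=> y cy; rewrite expr2 mulrA {1}(key y cy); ring.
  - by apply: (bmeasZ _ _).1; exact: bmeasD.
  rewrite bintZ; last exact: bmeasD.
  rewrite bintD// bintD//; last exact: bmeasZ.
  by rewrite bintZ// I11 Iq2 Iq; field.
(* The leading conj z of the conjugated dipole is absorbed by [geoE]: conj z * geo = conj z + a *
   geo on the circle. *)
have bzD y : circle c r y -> geo c a y * conjc (dipole c q y) =
    conjc (dipole c q y) + a * (geo c a y * conjc (geo c q y) ^+ 2).
  move=> cy; have zz := dir_conj r0 cy; have e := geoE c y a1.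
  rewrite [in LHS]e /dipole conjcM conjcX.
  move: (geo c a y) (dir c y) (conjc (dir c y)) (conjc (geo c q y)) zz {e} => A z zb B zz.
  by transitivity (zb * B ^+ 2 + a * (z * zb) * (A * B ^+ 2)); [ring|rewrite zz mulr1].
rewrite (eq_circle_bint (ltW r0) _ _ bzD); first last.
- by apply: (bmeasD _ _).1 => //; exact: bmeasZ.
- by apply: (bmeasM _ _).1.
rewrite bintD//; last exact: bmeasZ.
by rewrite bint_conj ?bint_dipole//; [rewrite bintZ// I12 conjc0 add0r mulrCA|exact: bmeas_dipole].
Qed.

End Hardy.

(** * Layer potentials and the Neumann-Poincaré operator *)

Section SingleLayer.
Variable R : realType.
Implicit Types (c v x y z : R * R) (r : R) (u : R * R -> R).
Local Notation plane := (measurableTypeR R * measurableTypeR R)%type.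

Lemma enorm_ge0 x : 0 <= enorm x. Proof. exact: sqrtr_ge0. Qed.

Lemma enormD x y : enorm (x + y) <= enorm x + enorm y.
Proof. by rewrite -!normc_toC toCD; exact: le_normcD. Qed.

Lemma enormN x : enorm (- x) = enorm x.
Proof. by rewrite -!normc_toC toCN normcN. Qed.

Lemma enormB x y : enorm x - enorm y <= enorm (x - y).
Proof. by rewrite lerBlDr -[x in leLHS](subrK y) enormD. Qed.

Lemma enormZ (a : R) x : enorm (a *: x) = `|a| * enorm x.
Proof.
rewrite /enorm /dot /= -sqrtr_sqr -sqrtrM ?sqr_ge0//; congr Num.sqrt.
by rewrite /GRing.scale/=; ring.
Qed.

Lemma sqr_enorm x : enorm x ^+ 2 = dot x x.
Proof. by rewrite sqr_sqrtr// addr_ge0// -expr2 sqr_ge0. Qed.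

Lemma dot_toC x y : dot x y = complex.Re (toC x * conjc (toC y)).
Proof. by rewrite /dot /= mulrN opprK. Qed.

Lemma dot_le x y : `|dot x y| <= enorm x * enorm y.
Proof.
by rewrite dot_toC (le_trans (Re_le_normc _))// ComplexField.Normc.normcM normcJ !normc_toC.
Qed.

(** The derivative of ln |x - y| at x in the direction v, which is the kernel of both K* and the
    normal derivative of a single layer. *)
Definition kern v x y : R := dot (x - y) v / enorm (x - y) ^+ 2.

Lemma measurable_sub1 x : measurable_fun [set: plane] (fun y : R * R => (x - y).1).
Proof. by apply: measurable_funB => //; exact: measurable_fst. Qed.

Lemma measurable_sub2 x : measurable_fun [set: plane] (fun y : R * R => (x - y).2).
Proof. by apply: measurable_funB => //; exact: measurable_snd. Qed.

Lemma measurable_dist x : measurable_fun [set: plane] (fun y : R * R => enorm (x - y)).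
Proof. by apply: measurable_enorm; [exact: measurable_sub1|exact: measurable_sub2]. Qed.

Lemma measurable_kern v x : measurable_fun [set: plane] (kern v x).
Proof.
have m1 := measurable_sub1 x; have m2 := measurable_sub2 x.
apply: measurable_funM; first exact: measurable_dot.
by apply: measurable_funV; apply: measurable_funX; exact: measurable_dist.
Qed.

Lemma kern_le v x y : `|kern v x y| <= enorm v / enorm (x - y).
Proof.
have [e0|e0] := eqVneq (enorm (x - y)) 0.
  by rewrite /kern e0 expr0n /= invr0 mulr0 normr0 mulr0.
have {}e0 : 0 < enorm (x - y) by rewrite lt_def e0 enorm_ge0.
rewrite /kern normrM (gtr0_norm (_ : 0 < _^-1)) ?invr_gt0 ?exprn_gt0//.
rewrite ler_pdivrMr ?exprn_gt0// (le_trans (dot_le _ _))//.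
by rewrite expr2 -mulrA mulKf ?gt_eqF// mulrC.
Qed.

(** Differentiation under the integral asks for its bounds at every point of the domain of
    integration, so this domain has to be cut down to the circle. *)
Lemma Rintegral_circle c r u : 0 <= r -> measurable_fun [set: plane] u ->
  \int[arclength c r]_y u y = \int[arclength c r]_(y in circle c r) u y.
Proof.
move=> r0 mu; have mc := measurable_circle c r.
rewrite [RHS]Rintegral_mkcond; apply: eq_circle_Rintegral => //.
  by apply/(measurable_restrictT u mc); exact: measurable_funTS.
by move=> y cy; rewrite patchE mem_set.
Qed.

Lemma circle_far c r x y : circle c r y -> enorm (x - c) - r <= enorm (x - y).
Proof.
move=> <-; rewrite (_ : x - y = (x - c) - (y - c)) ?enormB//.
by rewrite opprB addrA subrK.
Qed.

Lemma circle_near c r x y : circle c r y -> enorm (x - y) <= enorm (x - c) + r.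
Proof.
move=> <-; rewrite (_ : x - y = (x - c) + - (y - c)); last by rewrite opprB addrA subrK.
by rewrite (le_trans (enormD _ _))// enormN.
Qed.

(** Along a line this leaves the logarithm of a polynomial to differentiate. At the origin both
    sides are 0 by the default value of [ln]. *)
Lemma ln_enorm x : ln (enorm x) = 2^-1 * ln (dot x x).
Proof.
rewrite -sqr_enorm; have [x0|x0] := ltP 0 (enorm x).
  by rewrite lnXn// -[ln _ *+ 2]mulr_natl mulrA mulVf ?mul1r// pnatr_eq0.
have -> : enorm x = 0 by apply/eqP; rewrite eq_le x0 enorm_ge0.
by rewrite expr0n /= ln0// mulr0.
Qed.

Lemma norm_ln_le (a b e : R) : 0 < a -> a <= e -> e <= b ->
  `|ln e| <= `|ln a| + `|ln b|.
Proof.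
move=> a0 ae eb; have e0 : 0 < e by exact: lt_le_trans ae.
have lae : ln a <= ln e by rewrite ler_ln ?posrE.
have leb : ln e <= ln b by rewrite ler_ln ?posrE// (lt_le_trans e0).
have := ler_norm (- ln a); have := ler_norm (ln b).
have := normr_ge0 (ln a); have := normr_ge0 (ln b); rewrite normrN => *.
by rewrite ler_norml; apply/andP; split; lra.
Qed.

Lemma is_derive_ln_enorm v x y (t : R) : 0 < enorm (t *: v + x - y) ->
  is_derive t 1 (fun t : R => ln (enorm (t *: v + x - y))) (kern v (t *: v + x) y).
Proof.
move=> n0; pose D (s : R) := dot (s *: v + x - y) (s *: v + x - y).
have D0 : 0 < D t by rewrite /D -sqr_enorm exprn_gt0.
have dD : is_derive t 1 D (2 * dot (t *: v + x - y) v).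
  by rewrite /D /dot /=; apply: is_derive_eq; rewrite /GRing.scale/=; ring.
rewrite (_ : (fun _ => _) = (fun s => 2^-1 * ln (D s))); last first.
  by apply/funext => s; exact: ln_enorm.
have h : is_derive t 1 (@ln R \o D) ((D t)^-1 * (2 * dot (t *: v + x - y) v)).
  by apply: is_derive1_comp; exact: is_derive1_ln.
apply: is_derive_eq; rewrite /GRing.scale/= /kern sqr_enorm -/(D t).
by field; rewrite gt_eqF.
Qed.

Lemma is_derive_line (g : R * R -> R) (G : R -> R) x v (d : R) :
  (forall t, g (t *: v + x) = G t) -> is_derive (0 : R) 1 G d -> is_derive x v g d.
Proof.
move=> gG dG.
have gE : (fun h : R => h^-1 *: ((g \o shift x) (h *: v) - g x)) =
    (fun h : R => h^-1 *: ((G \o shift 0) (h *: 1) - G 0)).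
  apply/funext => h /=; rewrite gG -[x in g x]add0r -(scale0r v) gG.
  by rewrite addr0 [h *: 1]mulr1.
by case: dG => [dG DG]; split; rewrite /derivable ?/derive gE.
Qed.

(** A point outside the closed disk has positive distance [rho] to the circle. For small t the
    points x + t v keep at least half of it, so logarithm and kernel stay bounded and a multiple of
    |u| dominates. *)
Lemma is_derive_single_layer c r u x v : 0 < r -> r < enorm (x - c) ->
  measurable_fun [set: plane] u ->
  (arclength c r).-integrable setT (EFin \o u) ->
  is_derive x v (fun z => \int[arclength c r]_y (ln (enorm (z - y)) * u y))
    (\int[arclength c r]_y (kern v x y * u y)).
Proof.
move=> r0 xr mu iu.
pose rho := enorm (x - c) - r; have rho0 : 0 < rho by rewrite subr_gt0.
have rho20 : 0 < rho / 2 by rewrite divr_gt0.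
(* Chosen so that |t| < d moves x by at most rho / 2; the added 1 allows v = 0. *)
pose d := rho / (2 * (enorm v + 1)).
have v0 : 0 < enorm v + 1 by rewrite ltr_wpDl ?enorm_ge0.
have d0 : 0 < d by rewrite divr_gt0// mulr_gt0.
have dv : d * enorm v <= rho / 2.
  rewrite /d invfM mulrA -[leRHS]mulr1 -mulrA ler_pM2l//.
  by rewrite mulrC ler_pdivrMr// mul1r lerDl.
have tv (t : R) : `]- d, d[%classic t -> enorm (t *: v) <= rho / 2.
  rewrite /= in_itv /= -ltr_norml enormZ => td.
  by rewrite (le_trans _ dv)// ler_wpM2r ?enorm_ge0// ltW.
have far (t : R) y : `]- d, d[%classic t -> circle c r y ->
    rho / 2 <= enorm (t *: v + x - y).
  move=> /tv td cy; have := enormB (x - y) (- (t *: v)).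
  rewrite opprK enormN (addrC (x - y)) addrA; apply: le_trans.
  rewrite lerBrDr (le_trans _ (circle_far x cy))// -/rho.
  by rewrite [leRHS](splitr rho) lerD2l.
have near (t : R) y : `]- d, d[%classic t -> circle c r y ->
    enorm (t *: v + x - y) <= rho / 2 + (enorm (x - c) + r).
  move=> /tv td cy; rewrite -addrA (le_trans (enormD _ _))// lerD//.
  exact: circle_near.
have mln z : measurable_fun [set: plane] (fun y : R * R => ln (enorm (z - y)) * u y).
  by apply: measurable_funM => //; exact: (measurableT_comp (@measurable_ln R) (measurable_dist z)).
have mk z : measurable_fun [set: plane] (fun y : R * R => kern v z y * u y).
  by apply: measurable_funM => //; exact: measurable_kern.
have iZ (k : R) : (arclength c r).-integrable setT (EFin \o (fun y => k * `|u y|)).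
  by apply: (integrableZl _ k (integrable_norm iu)).
have iln (t : R) : `]- d, d[%classic t ->
    (arclength c r).-integrable setT (EFin \o (fun y => ln (enorm (t *: v + x - y)) * u y)).
  move=> td; apply: ae_integrable (iZ (`|ln (rho / 2)| + `|ln (rho / 2 + (enorm (x - c) + r))|)) => //.
  apply: (ae_circle (ltW r0)) => y cy; rewrite normrM ler_wpM2r//.
  by apply: norm_ln_le; [|exact: far|exact: near].
have kG (t : R) y : `]- d, d[%classic t -> circle c r y ->
    `|kern v (t *: v + x) y * u y| <= enorm v / (rho / 2) * `|u y|.
  move=> td cy; rewrite normrM ler_wpM2r// (le_trans (kern_le _ _ _))//.
  rewrite ler_wpM2l ?enorm_ge0// lef_pV2 ?posrE//; first exact: far td cy.
  exact: lt_le_trans (far _ _ td cy).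
have d0I : `]- d, d[%classic (0 : R) by rewrite /= in_itv /= oppr_lt0 d0.
have mc := measurable_circle c r.
pose f (t : R) y := ln (enorm (t *: v + x - y)) * u y.
have df (t : R) y : `]- d, d[%classic t -> circle c r y ->
    is_derive t 1 (f^~ y) (kern v (t *: v + x) y * u y).
  move=> td cy; have h := @is_derive_ln_enorm v x y t (lt_le_trans rho20 (far _ _ td cy)).
  by apply: is_derive_eq; rewrite scaler0 add0r /GRing.scale/= mulrC.
have pf (t : R) y : `]- d, d[%classic t -> circle c r y ->
    partial1of2 f t y = kern v (t *: v + x) y * u y.
  by move=> td cy; have [? h] := df t y td cy; rewrite partial1of2E h.
have -> : (fun z => \int[arclength c r]_y (ln (enorm (z - y)) * u y)) =
    (fun z => \int[arclength c r]_(y in circle c r) (ln (enorm (z - y)) * u y)).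
  by apply/funext => z; rewrite Rintegral_circle// ltW.
rewrite [X in is_derive _ _ _ X]Rintegral_circle ?ltW//.
have c1 (t : R) : `]- d, d[%classic t ->
    (arclength c r).-integrable (circle c r) (EFin \o f t).
  by move=> td; exact: (integrableS measurableT mc (@subsetT _ _) (iln t td)).
have c2 (t : R) (y : plane) : `]- d, d[%classic t -> circle c r y -> derivable (f^~ y) t 1.
  by move=> td cy; have [] := df t y td cy.
have c3 (y : plane) : 0 <= enorm v / (rho / 2) * `|u y|.
  by rewrite mulr_ge0// divr_ge0 ?enorm_ge0// ltW.
have c4 : (arclength c r).-integrable (circle c r) (EFin \o (fun y => enorm v / (rho / 2) * `|u y|)).
  exact: (integrableS measurableT mc (@subsetT _ _) (iZ _)).
have c5 (t : R) (y : plane) : `]- d, d[%classic t -> circle c r y ->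
    `|partial1of2 f t y| <= enorm v / (rho / 2) * `|u y|.
  by move=> td cy; rewrite pf// kG.
apply: (@is_derive_line _ (fun t : R => \int[arclength c r]_(y in circle c r) f t y)).
  by [].
have dF := derivable_under_integral mc d0I c1 c2 c3 c4 c5.
apply: DeriveDef; first exact: dF.
rewrite -derive1E (differentiation_under_integral mc d0I c1 c2 c3 c4 c5).
by apply: eq_Rintegral => y /set_mem cy; rewrite pf// scale0r add0r.
Qed.

End SingleLayer.

Section NeumannPoincare.
Variable R : realType.
Implicit Types (c v x y z : R * R) (r eps lam : R) (u : R * R -> R) (f g : R * R -> R[i]).
Local Notation plane := (measurableTypeR R * measurableTypeR R)%type.

(** If two parameters gave the same point, w = (t - s) / (2 r) would lie in ]0, pi[ with cos (2 w) =
    1, hence sin w = 0. *)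
Lemma arc_param_inj c r s t : 0 < r -> 0 <= s -> s < t -> t < 2 * pi * r ->
  arc_param c r s <> arc_param c r t.
Proof.
move=> r0 s0 st tT [/addrI/(mulfI (lt0r_neq0 r0)) ec /addrI/(mulfI (lt0r_neq0 r0)) es].
pose w := (t - s) / (2 * r).
have w0 : 0 < w by rewrite divr_gt0 ?subr_gt0// mulr_gt0.
have wpi : w < pi.
  rewrite ltr_pdivrMr ?mulr_gt0// (_ : pi * (2 * r) = 2 * pi * r); last by ring.
  by rewrite (le_lt_trans _ tT)// gerBl.
have : cos (w *+ 2) = 1.
  rewrite (_ : w *+ 2 = t / r - s / r); last by rewrite /w -mulr_natl; field; rewrite gt_eqF.
  by rewrite cosB -ec -es -!expr2 cos2Dsin2.
rewrite cos_mulr2n => /eqP; rewrite subr_eq -mulr2n eqr_pMn2r// => /eqP c1.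
have := cos2Dsin2 w; rewrite c1 => /eqP; rewrite -subr_eq0 addrAC subrr add0r sqrf_eq0.
by rewrite gt_eqF// sin_gt0_pi// w0.
Qed.

Lemma circle0 x : circle x 0 = [set x].
Proof.
apply/seteqP; split => [y|y ->]; rewrite /circle /=.
- by rewrite -normc_toC => /eqP; rewrite normc_eq0 => /eqP[] /subr0_eq e1 /subr0_eq e2;
    case: x y e1 e2 => ? ? [? ?] /= -> ->.
- by rewrite subrr -normc_toC; exact: ComplexField.Normc.normc0.
Qed.

Lemma arclength_set1 c r x : 0 < r -> arclength c r [set x] = 0%E.
Proof.
move=> r0; rewrite /arclength /pushforward /= /mrestr.
set A := _ `&` _; have [->|/set0P[s0 As0]] := eqVneq A set0; first exact: measure0.
rewrite (_ : A = [set s0]) ?lebesgue_measure_set1//.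
apply/seteqP; split => [s As|s ->//].
move: As0 As; rewrite /A /= !in_itv /= => -[e0 /andP[a0 b0]] [e1 /andP[a1 b1]].
have [ss|ss|//] := ltgtP s s0.
- by have := arc_param_inj r0 a1 ss b0 (etrans e1 (esym e0)).
- by have := arc_param_inj r0 a0 ss b1 (etrans e0 (esym e1)).
Qed.

(** For two points at equal distance from c, 2 <x - y, x - c> = |x - y|^2. *)
Lemma kern_circle c r x y : 0 < r -> circle c r x -> circle c r y -> x != y ->
  kern (normal c r x) x y = (2 * r)^-1.
Proof.
move=> r0 cx cy xy; rewrite /kern sqr_enorm.
have r0' : r != 0 by rewrite gt_eqF.
have n0 : dot (x - y) (x - y) != 0.
  rewrite -sqr_enorm sqrf_eq0; apply: contra xy => /eqP h.
  have : circle y 0 x by [].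
  by rewrite circle0 => ->.
have ex : dot (x - c) (x - c) = r ^+ 2 by rewrite -sqr_enorm cx.
have ey : dot (y - c) (y - c) = r ^+ 2 by rewrite -sqr_enorm cy.
have key : 2 * dot (x - y) (x - c) = dot (x - y) (x - y).
  apply/eqP; rewrite -subr_eq0.
  rewrite (_ : _ - _ = dot (x - c) (x - c) - dot (y - c) (y - c)); last by rewrite /dot /=; ring.
  by rewrite ex ey subrr.
rewrite -key in n0 *.
rewrite (_ : dot (x - y) (normal c r x) = r^-1 * dot (x - y) (x - c)); last first.
  by rewrite /dot /normal /= /GRing.scale /=; ring.
by move: n0; rewrite mulf_eq0 negb_or => /andP[_ n0]; field; rewrite n0 r0'.
Qed.

Definition layer c r u v x : R := (2 * pi)^-1 * \int[arclength c r]_y (kern v x y * u y).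

(** Half the average of u, the value that K* takes everywhere on the circle, as its kernel is
    constant there. *)
Definition mean_half c r u : R := (4 * pi * r)^-1 * \int[arclength c r]_y u y.

Lemma Rintegral_Kstar c r u x : 0 < r -> circle c r x -> measurable_fun [set: plane] u ->
  (arclength c r).-integrable setT (EFin \o u) ->
  (2 * pi)^-1 * \int[arclength c r]_y
    (dot (x - y) (normal c r x) / enorm (x - y) ^+ 2 * u y) = mean_half c r u.
Proof.
move=> r0 cx mu iu.
transitivity ((2 * pi)^-1 * \int[arclength c r]_y ((2 * r)^-1 * u y)).
  congr (_ * _); apply: eq_ae_Rintegral.
  - by apply: measurable_funM => //; exact: measurable_kern.
  - by apply: measurable_funM => //; exact: measurable_cst.
  - have h1 := ae_circle (ltW r0) (fun (y : plane) (cy : circle c r y) => cy).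
    (* At y = x the kernel has the default value 0 instead of 1 / (2 r), but a point has no
       length. *)
    have h2 : {ae arclength c r, forall y : plane, y != x}.
      exists [set x]; split; [|exact: arclength_set1|].
        by rewrite -circle0; exact: measurable_circle.
      by move=> y /= /negP; rewrite negbK => /eqP.
    apply: aeS2 h1 h2 => y cy yx; congr (_ * _).
    by apply: kern_circle => //; rewrite eq_sym.
rewrite RintegralZl// /mean_half mulrA; congr (_ * _).
by rewrite -invfM; congr (_^-1); ring.
Qed.

Definition cintegrable c r f : Prop := cmeasurable f /\
  (arclength c r).-integrable setT (EFin \o (fun y => complex.Re (f y))) /\
  (arclength c r).-integrable setT (EFin \o (fun y => complex.Im (f y))).

Lemma KstarE c r f x : 0 < r -> circle c r x -> cintegrable c r f ->
  Kstar c r f x = mean_half c r (fun y => complex.Re (f y)) +i*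
                  mean_half c r (fun y => complex.Im (f y)).
Proof.
move=> r0 cx [[mR mI] [iR iI]].
rewrite -(Rintegral_Kstar r0 cx mR iR) -(Rintegral_Kstar r0 cx mI iI).
rewrite /Kstar /bint; apply/eqP; rewrite eq_complex /=; apply/andP; split; apply/eqP.
- rewrite mul0r subr0; congr (_ * _); apply: eq_Rintegral => y _.
  by case: (f y) => a b /=; rewrite mul0r subr0.
- rewrite mul0r addr0; congr (_ * _); apply: eq_Rintegral => y _.
  by case: (f y) => a b /=; rewrite mul0r addr0.
Qed.

Lemma normal_derivativeE c r c' r' f x : 0 < r -> r < enorm (x - c) -> cintegrable c r f ->
  normal_derivative c' r' (single_layer c r f) x =
  layer c r (fun y => complex.Re (f y)) (normal c' r' x) x +i*
  layer c r (fun y => complex.Im (f y)) (normal c' r' x) x.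
Proof.
move=> r0 xr [[mR mI] [iR iI]]; set v := normal c' r' x.
have dR := @is_derive_single_layer R c r _ x v r0 xr mR iR.
have dI := @is_derive_single_layer R c r _ x v r0 xr mI iI.
have eR : (fun z => complex.Re (single_layer c r f z)) = (fun z => (2 * pi)^-1 *
    \int[arclength c r]_y (ln (enorm (z - y)) * complex.Re (f y))).
  apply/funext => z; rewrite /single_layer /bint /= mul0r subr0; congr (_ * _).
  by apply: eq_Rintegral => y _; case: (f y) => a b /=; rewrite mul0r subr0.
have eI : (fun z => complex.Im (single_layer c r f z)) = (fun z => (2 * pi)^-1 *
    \int[arclength c r]_y (ln (enorm (z - y)) * complex.Im (f y))).
  apply/funext => z; rewrite /single_layer /bint /= mul0r addr0; congr (_ * _).
  by apply: eq_Rintegral => y _; case: (f y) => a b /=; rewrite mul0r addr0.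
by rewrite /normal_derivative -/v eR eI !derive_val.
Qed.

(* [lam I - K] acting on real densities, [u] on the circle of center [c] where it
   is evaluated and [u'] on the circle of center [c']. *)
Definition density_op lam c r c' u u' x : R :=
  lam * u x - (mean_half c r u + layer c' r u' (normal c r x) x).

Lemma enorm_center r eps : 0 < r -> 0 < eps ->
  enorm (center2 r eps - center1 r eps) = 2 * r + eps.
Proof.
move=> r0 e0; rewrite -normc_toC (_ : toC _ = (2 * r + eps)%:C) ?normcR ?gtr0_norm//.
  by rewrite addr_gt0// mulr_gt0.
by apply/eqP; rewrite eq_complex /= subrr eqxx andbT; apply/eqP; field.
Qed.

Lemma circle_sep c c' r x : circle c r x -> 2 * r < enorm (c' - c) -> r < enorm (x - c').
Proof.
move=> cx; have := circle_far c' cx; rewrite -(enormN (c' - x)) opprB.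
by move=> h1 h2; apply: lt_le_trans h1; rewrite ltrBrDr -mulr2n -mulr_natl.
Qed.

(** All kernels and [lam] are real, so a complex system is two copies of one real system. *)
Lemma resolvent_op1E r eps lam (f : density2 R) x : 0 < r -> 0 < eps ->
  circle (center1 r eps) r x ->
  cintegrable (center1 r eps) r f.1 -> cintegrable (center2 r eps) r f.2 ->
  (resolvent_op r eps lam f).1 x =
  density_op lam (center1 r eps) r (center2 r eps) (fun y => complex.Re (f.1 y))
    (fun y => complex.Re (f.2 y)) x +i*
  density_op lam (center1 r eps) r (center2 r eps) (fun y => complex.Im (f.1 y))
    (fun y => complex.Im (f.2 y)) x.
Proof.
move=> r0 e0 cx i1 i2.
have far : r < enorm (x - center2 r eps).
  by apply: circle_sep cx _; rewrite enorm_center// ltrDl.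
rewrite /resolvent_op /NPop /= (KstarE r0 cx i1) (normal_derivativeE _ _ r0 far i2).
rewrite /density_op; case: (f.1 x) => a b; apply/eqP; rewrite eq_complex /=.
by apply/andP; split; apply/eqP; rewrite ?mul0r ?subr0 ?addr0.
Qed.

Lemma resolvent_op2E r eps lam (f : density2 R) x : 0 < r -> 0 < eps ->
  circle (center2 r eps) r x ->
  cintegrable (center1 r eps) r f.1 -> cintegrable (center2 r eps) r f.2 ->
  (resolvent_op r eps lam f).2 x =
  density_op lam (center2 r eps) r (center1 r eps) (fun y => complex.Re (f.2 y))
    (fun y => complex.Re (f.1 y)) x +i*
  density_op lam (center2 r eps) r (center1 r eps) (fun y => complex.Im (f.2 y))
    (fun y => complex.Im (f.1 y)) x.
Proof.
move=> r0 e0 cx i1 i2.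
have far : r < enorm (x - center1 r eps).
  by apply: circle_sep cx _; rewrite -opprB enormN enorm_center// ltrDl.
rewrite /resolvent_op /NPop /= (KstarE r0 cx i2) (normal_derivativeE _ _ r0 far i1).
rewrite /density_op; case: (f.2 x) => a b; apply/eqP; rewrite eq_complex /=.
by apply/andP; split; apply/eqP; rewrite ?mul0r ?subr0 ?addr0 // [layer _ _ _ _ _ + _]addrC.
Qed.

End NeumannPoincare.

(** * Uniqueness in L1 *)

Section KernelIntegral.
Context d1 d2 (T1 : measurableType d1) (T2 : measurableType d2) (R : realType).
Variables (m1 : {finite_measure set T1 -> \bar R}) (m2 : {finite_measure set T2 -> \bar R}).

(** A Schur test in L1: Fubini moves the test function [g] onto the kernel, and only the integrals
    of g * k in x remain. Keeping [g] under the absolute value makes one lemma serve twice, with M =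
    0 for g = 1 and with M = pi for a sign function. *)
Lemma Rintegral_kernel_le (C1 : set T1) (C2 : set T2) (k : T1 -> T2 -> R)
    (g w : T1 -> R) (u : T2 -> R) (K M : R) :
  {ae m1, forall x, C1 x} -> {ae m2, forall y, C2 y} -> 0 <= K -> 0 <= M ->
  measurable_fun setT (fun p : T1 * T2 => k p.1 p.2) ->
  (forall x y, C1 x -> C2 y -> `|k x y| <= K) ->
  measurable_fun setT u -> m2.-integrable setT (EFin \o u) ->
  measurable_fun setT g -> (forall x, `|g x| <= 1) ->
  measurable_fun setT w ->
  {ae m1, forall x, w x = \int[m2]_y (k x y * u y)} ->
  (forall y, C2 y -> `|\int[m1]_x (g x * k x y)| <= M) ->
  `|\int[m1]_x (g x * w x)| <= M * \int[m2]_y `|u y|.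
Proof.
move=> C1ae C2ae K0 M0 mk kK mu iu mg g1 mw wE BM.
pose F (p : T1 * T2) : \bar R := (g p.1 * (k p.1 p.2 * u p.2))%:E.
have mF : measurable_fun setT F.
  apply/measurable_EFinP; apply: measurable_funM.
    exact: measurableT_comp.
  by apply: measurable_funM => //; exact: measurableT_comp.
have inorm : m2.-integrable setT (EFin \o (fun y => `|u y|)) := integrable_norm iu.
have iKu : m2.-integrable setT (EFin \o (fun y => K * `|u y|)).
  exact: (integrableZl _ K inorm).
have mkx x : measurable_fun setT (fun y => k x y).
  exact: (measurableT_comp mk (pair1_measurable x)).
have mky y : measurable_fun setT (fun x => k x y).
  exact: (measurableT_comp mk (pair2_measurable y)).
have iku x : C1 x -> m2.-integrable setT (EFin \o (fun y => k x y * u y)).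
  move=> cx; apply: ae_integrable iKu; first exact: measurable_funM.
  by apply: aeS C2ae => y cy; rewrite normrM ler_wpM2r// kK.
have igk y : C2 y -> m1.-integrable setT (EFin \o (fun x => g x * k x y)).
  move=> cy; apply: (@ae_integrable _ _ _ _ _ (cst K)).
  - exact: measurable_funM.
  - by apply: aeS C1ae => x cx; rewrite normrM -[leRHS]mul1r ler_pM// kK.
  - exact: finite_measure_integrable_cst.
have mFx x : measurable_fun setT (fun y => g x * (k x y * u y)).
  by apply: measurable_funM; [exact: measurable_cst|exact: measurable_funM].
(* Fubini is legitimate because the kernel is bounded by K between the carriers [C1] and [C2]. *)
have iF : (m1 \x m2)%E.-integrable setT F.
  apply/integrable12ltyP => //.
  apply: (@le_lt_trans _ _ (\int[m1]_x ((\int[m2]_y (K * `|u y|))%:E))%E).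
    apply: ae_ge0_le_integral => //.
    - by move=> x _; exact: integral_ge0.
    - by apply: (measurable_fun_fubini_tonelli_F (abse \o F)) => //=; exact: measurableT_comp.
    - by move=> x _; rewrite lee_fin; apply: Rintegral_ge0 => y _; rewrite mulr_ge0.
    apply: aeS C1ae => x cx _; rewrite -EFin_Rintegral//; apply: ae_ge0_le_integral => //.
    - apply/measurable_EFinP; exact: (measurableT_comp (@normr_measurable R setT) (mFx x)).
    - by move=> y _; rewrite lee_fin mulr_ge0.
    - by apply/measurable_EFinP; apply: measurable_funM => //; exact: measurableT_comp.
    apply: aeS C2ae => y cy _; rewrite lee_fin !normrM -[leRHS]mul1r ler_pM ?mulr_ge0//.
    by rewrite ler_wpM2r// kK.
  rewrite integral_cst//= lte_mul_pinfty//.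
    by rewrite lee_fin; apply: Rintegral_ge0 => y _; rewrite mulr_ge0.
  by rewrite ltey_eq fin_num_measure.
have e1 : (\int[m1]_x (g x * w x)%:E = \int[m1]_x \int[m2]_y F (x, y))%E.
  apply: ae_eq_integral => //.
  - by apply/measurable_EFinP; exact: measurable_funM.
  - exact: measurable_fubini_F iF.
  apply: aeS2 C1ae wE => x cx wx _; rewrite /F/= EFin_Rintegral.
    by rewrite RintegralZl ?wx//; exact: iku.
  exact: (integrableZl _ (g x) (iku _ cx)).
have e2 y : C2 y -> (\int[m1]_x F (x, y) = (u y * \int[m1]_x (g x * k x y))%:E)%E.
  move=> cy; rewrite -RintegralZl ?igk// -EFin_Rintegral; last exact: (integrableZl _ (u y) (igk _ cy)).
  by apply: eq_integral => x _; rewrite /F/=; congr (_%:E); ring.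
have iw : m1.-integrable setT (EFin \o (fun x => g x * w x)).
  apply/integrableP; split; first by apply/measurable_EFinP; exact: measurable_funM.
  have := integrable_fubini_F iF => /integrableP[mFF]; apply: le_lt_trans.
  apply: ae_ge0_le_integral => //.
  - by apply/measurable_EFinP; apply: measurableT_comp => //; exact: measurable_funM.
  - by apply: measurableT_comp.
  apply: aeS2 C1ae wE => x cx wx _; rewrite /fubini_F /F/= EFin_Rintegral.
    by rewrite RintegralZl ?wx//; exact: iku.
  exact: (integrableZl _ (g x) (iku _ cx)).
rewrite -lee_fin EFin_normr_Rintegral// e1 (Fubini iF).
apply: (@le_trans _ _ (\int[m2]_y `|\int[m1]_x F (x, y)|)%E).
  by apply: le_abse_integral => //; exact: measurable_fubini_G iF.
rewrite -RintegralZl// -EFin_Rintegral; last exact: (integrableZl _ M inorm).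
apply: ae_ge0_le_integral => //.
- by apply: measurableT_comp => //; exact: measurable_fubini_G iF.
- by move=> y _; rewrite lee_fin mulr_ge0.
- by apply/measurable_EFinP; apply: measurable_funM => //; exact: measurableT_comp.
by apply: aeS C2ae => y cy _; rewrite e2//= lee_fin normrM mulrC ler_wpM2r// BM.
Qed.

End KernelIntegral.

(** * Contraction by the off-diagonal operators *)

Section LayerContraction.
Variable R : realType.
Implicit Types (c v x y z : R * R) (r eps lam : R) (u : R * R -> R) (f : R * R -> R[i]).
Local Notation plane := (measurableTypeR R * measurableTypeR R)%type.

Lemma kernE v x y : kern v x y = complex.Re (toC v / toC (x - y)).
Proof. by rewrite /kern sqr_enorm /dot /= !expr2 mulrDl; ring. Qed.

Lemma toCZ (a : R) x : toC (a *: x) = a%:C * toC x.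
Proof.
by apply/eqP; rewrite eq_complex /= !mul0r subr0 addr0 !eqxx.
Qed.

Lemma toC_normal c r x : circle c r x -> toC (normal c r x) = dir c x.
Proof.
move=> cx; rewrite (dir_circle cx) /normal toCZ mulrC.
by rewrite (fmorphV (real_complex R)).
Qed.

Lemma measurable_kern2 c r :
  measurable_fun setT (fun p : plane * plane => kern (normal c r p.1) p.1 p.2).
Proof.
have m1 : measurable_fun setT (fun p : plane * plane => p.1.1).
  exact: (measurableT_comp measurable_fst measurable_fst).
have m2 : measurable_fun setT (fun p : plane * plane => p.1.2).
  exact: (measurableT_comp measurable_snd measurable_fst).
have m3 : measurable_fun setT (fun p : plane * plane => p.2.1).
  exact: (measurableT_comp measurable_fst measurable_snd).
have m4 : measurable_fun setT (fun p : plane * plane => p.2.2).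
  exact: (measurableT_comp measurable_snd measurable_snd).
have d1 : measurable_fun setT (fun p : plane * plane => ((p.1 : R * R) - p.2).1).
  exact: measurable_funB.
have d2 : measurable_fun setT (fun p : plane * plane => ((p.1 : R * R) - p.2).2).
  exact: measurable_funB.
apply: measurable_funM.
  apply: measurable_dot => //; apply: measurable_funM; rewrite ?measurable_cst//.
    by apply: measurable_funB => //; exact: measurable_cst.
  by apply: measurable_funB => //; exact: measurable_cst.
apply: measurable_funV; apply: measurable_funX; exact: measurable_enorm.
Qed.

(** With x - c = r z and Y = y - c, the complex kernel is z / (r z - Y). Its pole lies outside the
    circle, so as a function of x it is analytic in the disk and vanishes at the center. *)
Lemma kern_circle_outside c r x y : 0 < r -> circle c r x -> r < enorm (y - c) ->
  kern (normal c r x) x y =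
  complex.Re (- (toC (y - c))^-1 * (dir c x * geo c (r%:C / toC (y - c)) x)).
Proof.
move=> r0 cx yr; rewrite kernE (toC_normal cx) /geo (dir_circle cx).
have Y0 : toC (y - c) != 0.
  by rewrite -normc_eq0 normc_toC gt_eqF// (lt_trans r0).
have rC0 : r%:C != 0 by apply/eqP => -[] /eqP; rewrite gt_eqF.
have d0 : toC (y - c) - toC (x - c) != 0.
  rewrite subr_eq0; apply: contraTN yr => /eqP e.
  by rewrite -normc_toC e normc_toC cx ltxx.
rewrite (_ : x - y = (x - c) - (y - c)); last by rewrite opprB addrA subrK.
rewrite (toCB (x - c)); congr complex.Re; move: (toC (x - c)) (toC (y - c)) r%:C Y0 d0 rC0 => X Y s Y0 d0 s0.
by field; rewrite Y0 s0 d0 /=; rewrite -opprB oppr_eq0.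
Qed.

Lemma normc_ratio_lt1 c r y : 0 < r -> r < enorm (y - c) -> normc (r%:C / toC (y - c)) < 1.
Proof.
move=> r0 yr; rewrite ComplexField.Normc.normcM ComplexField.Normc.normcV normcR normc_toC.
by rewrite gtr0_norm// ltr_pdivrMr ?mul1r// (lt_trans r0).
Qed.

Lemma measurable_kern1 c r y : measurable_fun setT (fun x : plane => kern (normal c r x) x y).
Proof. exact: (measurableT_comp (measurable_kern2 c r) (pair2_measurable (y : plane))). Qed.

(** Gauss: a charge outside the disk sends no net flux through the circle. *)
Lemma Rintegral_kern c r y : 0 < r -> r < enorm (y - c) ->
  \int[arclength c r]_x kern (normal c r x) x y = 0.
Proof.
move=> r0 yr; have b1 := normc_ratio_lt1 r0 yr; set b := r%:C / _ in b1.
pose G x := - (toC (y - c))^-1 * (dir c x * geo c b x).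
have bG : bmeas (fun x => dir c x * geo c b x).
  by apply: bmeasM; [exact: bmeas_dir|exact: bmeas_geo].
transitivity (complex.Re (bint c r G)).
  apply: (eq_circle_Rintegral (ltW r0)); first exact: measurable_kern1.
    by case: (bmeasZ (- (toC (y - c))^-1) bG) => [[]].
  by move=> x cx; exact: kern_circle_outside.
rewrite bintZ// (_ : bint _ _ _ = 0) ?mulr0//.
have := (hardy_geo r0 b1 (hardy1 c r0)).2 0; rewrite -/b => h; rewrite -[RHS]h.
by congr bint; apply/funext => x; rewrite expr1 mulr1.
Qed.

(* [1 - 2 * r * kern] is the Poisson kernel of the exterior of the disk. *)
Lemma kern_le_half c r x y : 0 < r -> circle c r x -> r < enorm (y - c) ->
  kern (normal c r x) x y <= (2 * r)^-1.
Proof.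
move=> r0 cx yr.
have xy0 : 0 < enorm (x - y).
  have := enormB (y - c) (x - c); rewrite cx => h.
  rewrite -enormN opprB (_ : y - x = (y - c) - (x - c)); last by rewrite opprB addrA subrK.
  by apply: lt_le_trans h; rewrite subr_gt0.
rewrite /kern ler_pdivrMr ?exprn_gt0// sqr_enorm.
have ex : dot (x - c) (x - c) = r ^+ 2 by rewrite -sqr_enorm cx.
have ey : r ^+ 2 <= dot (y - c) (y - c).
  by rewrite -sqr_enorm ler_pXn2r ?nnegrE ?enorm_ge0 ?(ltW r0) ?(ltW yr).
rewrite (_ : dot (x - y) (normal c r x) = r^-1 * dot (x - y) (x - c)); last first.
  by rewrite /dot /normal /= /GRing.scale /=; ring.
have key : 2 * dot (x - y) (x - c) =
    dot (x - y) (x - y) + dot (x - c) (x - c) - dot (y - c) (y - c).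
  by rewrite /dot /=; ring.
rewrite invfM mulrAC [X in X <= _]mulrC ler_pM2r ?invr_gt0//; lra.
Qed.

Section TwoCircles.
Variables (c c' : R * R) (r : R).
Hypotheses (r0 : 0 < r) (sep : 2 * r < enorm (c' - c)).

Lemma kern_bound x y : circle c r x -> circle c' r y ->
  `|kern (normal c r x) x y| <= (enorm (c' - c) - 2 * r)^-1.
Proof.
move=> cx cy; have d0 : 0 < enorm (c' - c) - 2 * r by rewrite subr_gt0.
have xy : enorm (c' - c) - 2 * r <= enorm (x - y).
  have := circle_far x cy; apply: le_trans; have := circle_far c' cx.
  rewrite -(enormN (c' - x)) opprB; lra.
rewrite (le_trans (kern_le _ _ _))// /normal enormZ cx gtr0_norm ?invr_gt0//.
by rewrite mulVf ?gt_eqF// mul1r lef_pV2 ?posrE// (lt_le_trans d0).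
Qed.

Lemma circle_outside y : circle c' r y -> r < enorm (y - c).
Proof. by move=> cy; apply: (circle_sep cy); rewrite -opprB enormN. Qed.

Variables (u w : plane -> R).
Hypotheses (mu : measurable_fun setT u)
  (iu : (arclength c' r).-integrable setT (EFin \o u))
  (iw : (arclength c r).-integrable setT (EFin \o w))
  (wE : {ae arclength c r, forall x, w x = layer c' r u (normal c r x) x}).

Let K := (enorm (c' - c) - 2 * r)^-1.

Let K0 : 0 <= K. Proof. by rewrite invr_ge0 subr_ge0 ltW. Qed.

Let mw : measurable_fun setT w.
Proof. by case/integrableP : iw => /measurable_EFinP. Qed.

Let ae_circle1 : {ae arclength c r, forall x, circle c r x}.
Proof. exact: ae_circle (ltW r0) _. Qed.

Let ae_circle2 : {ae arclength c' r, forall x, circle c' r x}.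
Proof. exact: ae_circle (ltW r0) _. Qed.

Let wE2 : {ae arclength c r, forall x,
  2 * pi * w x = \int[arclength c' r]_y (kern (normal c r x) x y * u y)}.
Proof.
apply: aeS wE => x ->; rewrite /layer mulVKf//.
by rewrite mulf_neq0 ?pnatr_eq0// gt_eqF// pi_gt0.
Qed.

Let m2piw : measurable_fun setT (fun x => 2 * pi * w x).
Proof. by apply: measurable_funM => //; exact: measurable_cst. Qed.

(** The Schur test with g = 1, where the zero flux of each exterior charge allows M = 0. *)
Lemma Rintegral_layer : \int[arclength c r]_x w x = 0.
Proof.
have pi0 : 2 * pi != 0 :> R by rewrite mulf_neq0 ?pnatr_eq0// gt_eqF// pi_gt0.
have h (y : plane) : circle c' r y ->
    `|\int[arclength c r]_x (cst 1 x * kern (normal c r x) x y)| <= 0.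
  move=> cy; under eq_Rintegral do rewrite mul1r.
  by rewrite (Rintegral_kern r0 (circle_outside cy)) normr0.
have g1 (x : plane) : `|cst (1 : R) x| <= 1 by rewrite normr1.
have := Rintegral_kernel_le ae_circle1 ae_circle2 K0 (lexx 0) (measurable_kern2 c r)
  kern_bound mu iu (measurable_cst _) g1 m2piw wE2 h.
rewrite mul0r normr_le0; under eq_Rintegral do rewrite mul1r.
by rewrite RintegralZl// mulf_eq0 (negbTE pi0) => /eqP.
Qed.

(* As [u] has mean zero, [kern] may be replaced by [kern - (2 * r)^-1], which is
   nonpositive with integral [- pi] in [x]. *)
Lemma layer_contraction (g : plane -> R) : \int[arclength c' r]_y u y = 0 ->
  measurable_fun setT g -> (forall x, `|g x| <= 1) ->
  `|\int[arclength c r]_x (g x * w x)| <= 2^-1 * \int[arclength c' r]_y `|u y|.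
Proof.
move=> u0 mg g1; have pi0 : 0 < 2 * pi :> R by rewrite mulr_gt0 ?pi_gt0.
pose k x y := kern (normal c r x) x y - (2 * r)^-1.
have r20 : 0 <= (2 * r)^-1 by rewrite invr_ge0 mulr_ge0// ltW.
have K1 : 0 <= K + (2 * r)^-1 by rewrite addr_ge0.
have kK x y : circle c r x -> circle c' r y -> `|k x y| <= K + (2 * r)^-1.
  move=> cx cy; rewrite (le_trans (ler_normB _ _))// (ger0_norm r20) lerD2r.
  exact: kern_bound.
have mk : measurable_fun setT (fun p : plane * plane => k p.1 p.2).
  by apply: measurable_funB; [exact: measurable_kern2|exact: measurable_cst].
have wE' : {ae arclength c r, forall x,
    2 * pi * w x = \int[arclength c' r]_y (k x y * u y)}.
  apply: aeS2 ae_circle1 wE2 => x cx ->.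
  have iku : (arclength c' r).-integrable setT
      (EFin \o (fun y => kern (normal c r x) x y * u y)).
    apply: (ae_integrable _ _ (integrableZl _ K (integrable_norm iu))) => //.
      by apply: measurable_funM => //; exact: measurable_kern.
    by apply: aeS ae_circle2 => y cy; rewrite normrM ler_wpM2r// kern_bound.
  rewrite [in RHS](_ : (fun y => _) = (fun y => kern (normal c r x) x y * u y - (2 * r)^-1 * u y)).
    by rewrite RintegralB//; [rewrite RintegralZl// u0 mulr0 subr0|exact: (integrableZl _ _ iu)].
  by apply/funext => y; rewrite /k mulrBl.
have h (y : plane) : circle c' r y ->
    `|\int[arclength c r]_x (g x * k x y)| <= pi.
  move=> cy; have yr := circle_outside cy.
  have mky : measurable_fun setT (fun x : plane => kern (normal c r x) x y) := measurable_kern1 c r y.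
  have ik : (arclength c r).-integrable setT (EFin \o (fun x => kern (normal c r x) x y)).
    by apply: (@integrable_bounded_circle _ _ _ _ K (ltW r0)) => // x cx; exact: kern_bound.
  have ic : (arclength c r).-integrable setT (EFin \o cst ((2 * r)^-1)).
    exact: finite_measure_integrable_cst.
  have -> : pi = \int[arclength c r]_x ((2 * r)^-1 - kern (normal c r x) x y).
    rewrite RintegralB// (Rintegral_kern r0 yr) subr0 Rintegral_arclength_cst ?ltW//.
    by field; rewrite gt_eqF.
  apply: le_ae_Rintegral.
  - by apply: measurable_funM => //; apply: measurable_funB => //; exact: measurable_cst.
  - exact: (integrableB measurableT ic ik).
  - apply: aeS ae_circle1 => x cx; rewrite normrM /k -[leRHS]mul1r ler_pM//.
    rewrite distrC ger0_norm// subr_ge0; exact: kern_le_half.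
have := Rintegral_kernel_le ae_circle1 ae_circle2 K1 (pi_ge0 _) mk kK mu iu mg g1 m2piw wE' h.
under eq_Rintegral do rewrite mulrCA.
rewrite RintegralZl//; last first.
  apply: (ae_integrable _ _ (integrable_norm iw)) => //; first exact: measurable_funM.
  by apply: aeW => x; rewrite normrM ler_piMl.
rewrite normrM (gtr0_norm pi0) -ler_pdivlMl// => hh; apply: le_trans hh _.
by rewrite mulrA invfM mulfVK// gt_eqF// pi_gt0.
Qed.

End TwoCircles.

End LayerContraction.

Section Uniqueness.
Variable R : realType.
Implicit Types (c v x y z : R * R) (r eps lam : R) (u : R * R -> R) (f : R * R -> R[i]).
Local Notation plane := (measurableTypeR R * measurableTypeR R)%type.

Section OneSide.
Variables (c c' : R * R) (r lam : R) (u u' : plane -> R).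
Hypotheses (r0 : 0 < r) (sep : 2 * r < enorm (c' - c)) (lam2 : 2^-1 < `|lam|).
Hypotheses (mu : measurable_fun setT u) (iu : (arclength c r).-integrable setT (EFin \o u)).
Hypotheses (mu' : measurable_fun setT u') (iu' : (arclength c' r).-integrable setT (EFin \o u')).
Hypothesis eqn : {ae arclength c r, forall x, density_op lam c r c' u u' x = 0}.

Let w x := lam * u x - mean_half c r u.

Let ilu : (arclength c r).-integrable setT (EFin \o (fun x => lam * u x)).
Proof. exact: (integrableZl _ lam iu). Qed.

Let im : (arclength c r).-integrable setT (EFin \o cst (mean_half c r u)).
Proof. exact: finite_measure_integrable_cst. Qed.

Let iw : (arclength c r).-integrable setT (EFin \o w).
Proof. exact: (integrableB measurableT ilu im). Qed.

Let wE : {ae arclength c r, forall x, w x = layer c' r u' (normal c r x) x}.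
Proof.
apply: aeS eqn => x /eqP; rewrite /density_op opprD addrA subr_eq0 => /eqP <-.
by [].
Qed.

(* Integrating the equation over the circle gives [(lam - 1/2) * int u = 0]. *)
Lemma density_mean0 : \int[arclength c r]_x u x = 0.
Proof.
have := Rintegral_layer r0 sep mu' iu' iw wE.
rewrite /w RintegralB// RintegralZl// Rintegral_arclength_cst ?ltW// /mean_half.
rewrite mulrA (_ : 2 * pi * r / (4 * pi * r) = 2^-1); last first.
  by move: (pi_gt0 R); move: (@pi R) => p p0; field; rewrite !gt_eqF.
move/eqP; rewrite -mulrBl mulf_eq0 subr_eq0 => /orP[/eqP l2|/eqP//].
by move: lam2; rewrite l2 gtr0_norm ?ltxx.
Qed.

(** Once the mean of u is known to be 0, the equation says that lam * u is the layer potential of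
    u'; testing it against the sign of u produces the L1 norm. *)
Lemma density_norm_le : \int[arclength c' r]_y u' y = 0 ->
  `|lam| * \int[arclength c r]_x `|u x| <= 2^-1 * \int[arclength c' r]_y `|u' y|.
Proof.
(* [g] is the sign of u, with value 0 where u vanishes. *)
move=> u'0; pose g x := u x * `|u x|^-1.
have mnu : measurable_fun setT (fun x => `|u x|) by exact: measurableT_comp.
have mg : measurable_fun setT g by apply: measurable_funM => //; exact: measurable_funV.
have g1 x : `|g x| <= 1.
  by rewrite normrM normfV normr_id; have [->|u0] := eqVneq (u x) 0; rewrite ?normr0 ?mul0r// divff ?normr_eq0.
have := layer_contraction r0 sep mu' iu' iw wE u'0 mg g1; apply: le_trans.
rewrite (_ : (fun x => g x * w x) = (fun x => lam * `|u x|)); last first.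
  apply/funext => x; rewrite /w /mean_half density_mean0 mulr0 subr0 mulrCA; congr (_ * _).
  rewrite /g mulrAC -expr2; have [->|u0] := eqVneq (u x) 0; first by rewrite normr0 expr0n mul0r.
  by rewrite -real_normK ?num_real// expr2 mulfK ?normr_eq0.
rewrite RintegralZl//; last exact: integrable_norm iu.
by rewrite normrM ler_wpM2l// ler_norm.
Qed.

End OneSide.

(** Adding the two inequalities gives (l - 1/2) * (a + b) <= 0. *)
Lemma contraction_eq0 (l a b : R) : 2^-1 < l -> 0 <= a -> 0 <= b ->
  l * a <= 2^-1 * b -> l * b <= 2^-1 * a -> a = 0.
Proof.
move=> l2 a0 b0 ab ba; apply/eqP; rewrite eq_le a0 andbT.
have : (l - 2^-1) * (a + b) <= (l - 2^-1) * 0 by rewrite mulr0; lra.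
rewrite ler_pM2l ?subr_gt0//; lra.
Qed.

Lemma ae_eq0 c r u : measurable_fun [set: plane] u ->
  (arclength c r).-integrable setT (EFin \o u) ->
  \int[arclength c r]_x `|u x| = 0 -> {ae arclength c r, forall x, u x = 0}.
Proof.
move=> mu iu u0; have mEu : measurable_fun setT (EFin \o u) by exact/measurable_EFinP.
have /(ae_eq_integral_abs (arclength c r) measurableT mEu) : (\int[arclength c r]_x `|(EFin \o u) x| = 0)%E.
  by rewrite (EFin_Rintegral (integrable_norm iu)) u0.
by apply: aeS => x /(_ I)[].
Qed.

Lemma density_system_inj lam c c' r (u u' : plane -> R) : 0 < r ->
  2 * r < enorm (c' - c) -> 2^-1 < `|lam| ->
  measurable_fun setT u -> (arclength c r).-integrable setT (EFin \o u) ->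
  measurable_fun setT u' -> (arclength c' r).-integrable setT (EFin \o u') ->
  {ae arclength c r, forall x, density_op lam c r c' u u' x = 0} ->
  {ae arclength c' r, forall x, density_op lam c' r c u' u x = 0} ->
  {ae arclength c r, forall x, u x = 0} /\ {ae arclength c' r, forall x, u' x = 0}.
Proof.
move=> r0 sep lam2 mu iu mu' iu' e e'.
have sep' : 2 * r < enorm (c - c') by rewrite -opprB enormN.
have u0 := density_mean0 r0 sep lam2 iu mu' iu' e.
have u'0 := density_mean0 r0 sep' lam2 iu' mu iu e'.
have := density_norm_le r0 sep lam2 mu iu mu' iu' e u'0.
have := density_norm_le r0 sep' lam2 mu' iu' mu iu e' u0.
have n0 : 0 <= \int[arclength c r]_x `|u x| by apply: Rintegral_ge0.
have n'0 : 0 <= \int[arclength c' r]_x `|u' x| by apply: Rintegral_ge0.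
by move=> h h'; split; apply: ae_eq0 => //;
  [exact: contraction_eq0 lam2 _ _ h' h|exact: contraction_eq0 lam2 _ _ h h'].
Qed.

End Uniqueness.

(** * Image dipoles *)

Section GeometricSeries.
Variable R : realType.

Lemma sum_geometric_le (a : nat -> R) (B q : R) N M : 0 <= q -> q < 1 ->
  (forall m, `|a m| <= B * q ^+ m) ->
  `|\sum_(N <= m < M) a m| <= B * q ^+ N / (1 - q).
Proof.
move=> q0 q1 aB; have q1' : 0 < 1 - q by rewrite subr_gt0.
have B0 : 0 <= B by have := aB 0; rewrite expr0 mulr1; exact: le_trans.
have BN0 : 0 <= B * q ^+ N / (1 - q) by rewrite divr_ge0 ?mulr_ge0 ?exprn_ge0 ?(ltW q1').
have [MN|/ltnW NM] := leqP M N; first by rewrite big_geq// normr0.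
rewrite (le_trans (ler_norm_sum _ _ _))//.
apply: (@le_trans _ _ (\sum_(N <= m < M) B * q ^+ m)); first exact: ler_sum.
have geo : (\sum_(N <= m < M) q ^+ m) * (1 - q) = q ^+ N - q ^+ M.
  elim: M NM => [|M IH]; first by rewrite leqn0 => /eqP ->; rewrite big_geq// mul0r subrr.
  rewrite leq_eqVlt => /orP[/eqP <-|]; first by rewrite big_geq// mul0r subrr.
  by rewrite ltnS => NM; rewrite big_nat_recr//= mulrDl IH// exprS; ring.
rewrite ler_pdivlMr// -mulr_sumr -mulrA ler_wpM2l// geo lerBlDr lerDl.
exact: exprn_ge0.
Qed.

(** The explicit tail is uniform in any parameter that [B] and [q] do not depend on; this replaces
    dominated convergence when series are integrated term by term. *)
Lemma geometric_tail (a : nat -> R) (B q : R) : 0 <= q -> q < 1 ->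
  (forall m, `|a m| <= B * q ^+ m) ->
  series a @ \oo --> limn (series a) /\
  forall N, `|limn (series a) - series a N| <= B * q ^+ N / (1 - q).
Proof.
move=> q0 q1 aB.
have B0 : 0 <= B by have := aB 0; rewrite expr0 mulr1; exact: le_trans.
have ca : cvgn (series a).
  apply: normed_cvg; apply: (@series_le_cvg _ _ (geometric B q)) => //.
  - by move=> n; exact: normr_ge0.
  - by move=> n; rewrite /geometric/= mulr_ge0// exprn_ge0.
  - by apply: is_cvg_geometric_series; rewrite ger0_norm.
split=> // N.
have cN : (fun M => `|series a M - series a N|) @ \oo --> `|limn (series a) - series a N|.
  by apply: cvg_norm; apply: cvgB => //; exact: cvg_cst.
rewrite -(cvg_lim _ cN)//; apply: limr_le; first by apply/cvg_ex; eexists; exact: cN.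
by exists N => // M /= NM; rewrite sub_series_geq// sum_geometric_le.
Qed.

End GeometricSeries.

Section DipoleReflection.
Variable R : realType.
Implicit Types (c v x y z : R * R) (q s t : R) (f : R * R -> R[i]).
Local Notation plane := (measurableTypeR R * measurableTypeR R)%type.

(** All images stay on the axis through the centers, so a real parameter is enough. *)
Definition rdipole c q y : R := complex.Re (dipole c q%:C y).

Lemma normcR_lt1 q : `|q| < 1 -> normc q%:C < 1. Proof. by rewrite normcR. Qed.

Lemma measurable_rdipole c q : `|q| < 1 -> measurable_fun [set: plane] (rdipole c q).
Proof. by move=> /normcR_lt1 q1; case: (bmeas_dipole c q1) => [[]]. Qed.

Lemma rdipole_le c q y (t : R) : t < 1 -> `|q| <= t -> `|rdipole c q y| <= (1 - t)^-1 ^+ 2.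
Proof.
move=> t1 qt; have q1 : `|q| < 1 := le_lt_trans qt t1.
rewrite (le_trans (Re_le_normc _))// ComplexField.Normc.normcM normcX.
rewrite -[leRHS]mul1r ler_pM ?normc_ge0 ?exprn_ge0 ?dir_le1 ?normc_ge0//.
rewrite ler_pXn2r ?nnegrE ?normc_ge0 ?invr_ge0 ?subr_ge0 ?(ltW t1)//.
rewrite (le_trans (normc_geo _ _ (normcR_lt1 q1)))// normcR.
by rewrite lef_pV2 ?posrE ?subr_gt0// lerD2l lerN2.
Qed.

Lemma ReM (z w : R[i]) :
  complex.Re z * complex.Re w = 2^-1 * complex.Re (z * w + z * conjc w).
Proof. by case: z w => a b [d e] /=; field. Qed.

Lemma ReZ (t : R) (z : R[i]) : complex.Re (t%:C * z) = t * complex.Re z.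
Proof. by case: z => a b; rewrite /= mul0r subr0. Qed.

(** The algebraic core of [layer_rdipole], with p = pi, s = r, k = q, d = D and e the unit normal at
    x. Then s * e + d is x - c, and - s / (d - s * k) is the reflected parameter. *)
Lemma image_charge_identity (p s k d e : R[i]) : (2 : R[i]) != 0 -> p != 0 ->
  s * e + d != 0 -> s * e + d - s * k != 0 -> d - s * k != 0 ->
  (2 * p)^-1 * (2^-1 * (e / (s * e + d) *
    (2 * p * s * (s / (s * e + d) / (1 - s / (s * e + d) * k) ^+ 2)))) =
  2^-1 * (- s / (d - s * k) * (- s / (d - s * k))) *
    (e * (1 - - s / (d - s * k) * e)^-1 ^+ 2).
Proof.
move=> two0 p0 X0 XC0 dk0; field; rewrite ?p0 ?X0 ?XC0 ?dk0 ?two0 ?andbT//=.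
by rewrite mulNr opprK addrAC [d + _]addrC.
Qed.

(** Outside its disk, the potential of the density [rdipole c q] is that of a dipole at c + r q.
    Seen from c' this point is at -(D - r q), and equating it with r / q' gives the reflected
    parameter. *)
Lemma layer_rdipole c c' (r q D : R) x : 0 < r -> `|q| < 1 ->
  toC (c' - c) = D%:C -> 2 * r < `|D| -> circle c' r x ->
  let q' := - r / (D - r * q) in
  layer c r (rdipole c q) (normal c' r x) x = 2^-1 * q' ^+ 2 * rdipole c' q' x.
Proof.
move=> r0 q1 cD Dr cx q'; have q1C := normcR_lt1 q1.
have xr : r < enorm (x - c).
  by apply: (circle_sep cx); rewrite -enormN opprB -normc_toC cD normcR.
have a1 := normc_ratio_lt1 r0 xr; set a := r%:C / toC (x - c) in a1.
set eta := dir c' x; pose A := eta / toC (x - c).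
have X0 : toC (x - c) != 0.
  by rewrite -normc_eq0 normc_toC gt_eqF// (lt_trans r0).
(* As a function of y the kernel is the real part of an analytic function, with pole at x. *)
have kE y : circle c r y -> kern (normal c' r x) x y = complex.Re (A * geo c a y).
  move=> cy; rewrite kernE (toC_normal cx) -/eta /A /geo (dir_circle cy) /a.
  have rC0 : r%:C != 0 by apply/eqP => -[] /eqP; rewrite gt_eqF.
  have d0 : toC (x - c) - toC (y - c) != 0.
    rewrite subr_eq0; apply: contraTN xr => /eqP e.
    by rewrite -normc_toC e normc_toC cy ltxx.
  rewrite (_ : x - y = (x - c) - (y - c)); last by rewrite opprB addrA subrK.
  rewrite (toCB (x - c)); congr complex.Re.
  move: (toC (x - c)) (toC (y - c)) r%:C X0 d0 rC0 => X Y s X0' d0 s0.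
  by field; rewrite X0' s0 d0.
have bg := bmeas_geo c a1; have bD := bmeas_dipole c q1C.
have b1 : bmeas (fun y => geo c a y * dipole c q%:C y) by exact: bmeasM.
have b2 : bmeas (fun y => geo c a y * conjc (dipole c q%:C y)).
  by apply: bmeasM => //; exact: bmeas_conj.
have bS := bmeasZ A (bmeasD b1 b2).
(* The product of two real parts splits into an analytic product, of integral 0, and a mixed one,
   evaluated by [bint_geo_conj_dipole]. *)
have I1 : \int[arclength c r]_y (kern (normal c' r x) x y * rdipole c q y) =
    complex.Re (bint c r (fun y => (2^-1)%:C * (A * (geo c a y * dipole c q%:C y +
       geo c a y * conjc (dipole c q%:C y))))).
  apply: (eq_circle_Rintegral (ltW r0)).
  - by apply: measurable_funM; [exact: measurable_kern|exact: measurable_rdipole].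
  - by case: (bmeasZ (2^-1)%:C bS) => [[]].
  - by move=> y cy; rewrite kE// ReM -ReZ !mulrDr !mulrA.
rewrite /layer I1 bintZ// bintZ; last exact: bmeasD.
rewrite bintD// bint_geo_dipole// bint_geo_conj_dipole// add0r conjc_real.
rewrite -ReZ /rdipole -ReZ; congr complex.Re.
have Dq0 : D - r * q != 0.
  rewrite subr_eq0; apply: contraTN Dr => /eqP ->.
  rewrite normrM (gtr0_norm r0) -leNgt mulrC ler_pM2r// ltW// (lt_trans q1)//.
  by rewrite ltr1n.
have Dq0C : D%:C - r%:C * q%:C != 0.
  by rewrite -rmorphM -rmorphB; apply/eqP => -[] /eqP; rewrite (negbTE Dq0).
have r0C : r%:C != 0 by apply/eqP => -[] /eqP; rewrite gt_eqF.
have aq0 : 1 - a * q%:C != 0.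
  by have := normc_lt1_den a1 q1C; rewrite conjc_real.
have XE : toC (x - c) = r%:C * eta + D%:C.
  rewrite -cD /eta (dir_circle cx) mulrC divfK// -toCD; congr toC.
  by rewrite addrA subrK.
have pi0 : (pi : R)%:C != 0 by apply/eqP => -[] /eqP; rewrite gt_eqF// pi_gt0.
have XC0 : r%:C * eta + D%:C - r%:C * q%:C != 0.
  rewrite -XE subr_eq0; apply: contra aq0 => /eqP h.
  by rewrite /a mulrAC -h divff// subrr.
have two0 : 2%:R != 0 :> R[i] by rewrite pnatr_eq0.
rewrite /dipole /geo -/eta /q' !(rmorphM, rmorphXn, fmorphV, rmorphN, rmorphB) /=.
rewrite -[2%:C]/(real_complex R 2) rmorph_nat.
rewrite /A /a XE; apply: image_charge_identity => //.
by rewrite -XE.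
Qed.

End DipoleReflection.

(** * The series of image dipoles *)

Section ImageSeries.
Variable R : realType.
Implicit Types (c v x y z : R * R) (q s t : R) (f : R * R -> R[i]).
Local Notation plane := (measurableTypeR R * measurableTypeR R)%type.

Lemma cvg_geometric_bound (a : nat -> R) (l C q : R) : 0 <= q -> q < 1 ->
  (forall N, `|l - a N| <= C * q ^+ N) -> a @ \oo --> l.
Proof.
move=> q0 q1 aC; have h : (fun N => C * q ^+ N) @ \oo --> 0.
  by rewrite -[X in _ --> X](mulr0 C); apply: cvgMr; apply: cvg_expr; rewrite ger0_norm.
apply/cvgrPdist_le => e e0; move/cvgrPdist_le : h => /(_ _ e0); apply: filterS => N.
by rewrite sub0r normrN => h; rewrite (le_trans (aC N))// (le_trans (ler_norm _)).
Qed.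

Variables (r L lam : R).
Hypotheses (r0 : 0 < r) (Lr : 2 * r < L) (lam2 : 2^-1 < `|lam|).

(* The [m]-th image dipole lies at distance [r / image_pos m] from the center of
   the circle, on the side of the other circle, hence at infinity for [m = 0]. *)
Fixpoint image_pos (m : nat) : R := if m is k.+1 then r / (L - r * image_pos k) else 0.

(** A reflection contributes u^2 / 2 by [layer_rdipole], and solving for the next density divides by
    lam. The start lam^-1 answers the uniform field. *)
Fixpoint image_weight (m : nat) : R :=
  if m is k.+1 then image_pos m ^+ 2 * image_weight k / (2 * lam) else lam^-1.

Local Notation u := image_pos.
Local Notation b := image_weight.

(** [rho] keeps every pole a fixed distance off the circle, which bounds the dipoles uniformly;
    [theta] is the ratio in the geometric bound on the weights. *)
Let rho := r / (L - r).
Let theta := (2 * `|lam|)^-1.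

Let Lr0 : 0 < L - r. Proof. by have := Lr; have := r0; lra. Qed.
Let rho0 : 0 <= rho. Proof. by rewrite divr_ge0// ltW. Qed.
Let rho1 : rho < 1. Proof. by rewrite ltr_pdivrMr// mul1r; have := Lr; lra. Qed.
Let lam0 : lam != 0. Proof. by rewrite -normr_gt0 (lt_trans _ lam2)// invr_gt0. Qed.
Let theta0 : 0 <= theta. Proof. by rewrite invr_ge0 mulr_ge0. Qed.
Let theta1 : theta < 1.
Proof.
by rewrite /theta invf_lt1 ?mulr_gt0 ?normr_gt0// -ltr_pdivrMl// mulr1.
Qed.

Lemma image_pos_bound m : 0 <= u m <= rho.
Proof.
elim: m => [|m /andP[um0 um1]]; first by rewrite lexx.
have um : u m <= 1 by rewrite (le_trans um1)// ltW.
have d0 : L - r <= L - r * u m by rewrite lerD2l lerN2 ler_piMr// ltW.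
have d1 : 0 < L - r * u m by exact: lt_le_trans d0.
apply/andP; split; first by rewrite /= divr_ge0// ltW.
by rewrite /= /rho ler_pM2l// lef_pV2 ?posrE.
Qed.

Lemma image_pos_lt1 m : u m < 1.
Proof. by have /andP[_ h] := image_pos_bound m; exact: le_lt_trans h rho1. Qed.

Lemma image_weightS m : b m.+1 = u m.+1 ^+ 2 * b m / (2 * lam).
Proof. by []. Qed.

Lemma image_weight_bound m : `|b m| <= `|lam|^-1 * theta ^+ m.
Proof.
elim: m => [|m IH]; first by rewrite expr0 mulr1 /= normfV.
rewrite image_weightS (normrM (_ * b m)) (normrM _ (b m)) normrX normfV (normrM 2).
rewrite (ger0_norm (_ : (0 : R) <= 2))// -/theta [theta ^+ _]exprSr mulrA.
apply: ler_wpM2r => //; apply: le_trans IH; rewrite ler_piMl//.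
have /andP[h0 h1] := image_pos_bound m.+1.
rewrite expr_le1 ?normr_ge0// ger0_norm ?h0//.
by rewrite (le_trans h1)// ltW.
Qed.

Let B := `|lam|^-1 * (1 - rho)^-1 ^+ 2.

Let B0 : 0 <= B.
Proof. by rewrite mulr_ge0 ?invr_ge0// exprn_ge0// invr_ge0 subr_ge0 ltW. Qed.

Section OneCircle.
Variables (c : R * R) (s : R).
Hypothesis s1 : `|s| = 1.

Let su m : `|s * u m| <= rho.
Proof.
by have /andP[h0 h1] := image_pos_bound m; rewrite normrM s1 mul1r ger0_norm.
Qed.

Let su1 m : `|s * u m| < 1. Proof. exact: le_lt_trans (su m) rho1. Qed.

Lemma image_term_bound y m : `|b m * rdipole c (s * u m) y| <= B * theta ^+ m.
Proof.
rewrite normrM /B mulrAC ler_pM//; first exact: image_weight_bound.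
exact: rdipole_le.
Qed.

(** The sign [s] turns the images towards the other disk: 1 on the left circle and -1 on the right
    one. *)
Definition image_density y : R := limn (series (fun m => b m * rdipole c (s * u m) y)).

Lemma cvg_image_density y :
  series (fun m => b m * rdipole c (s * u m) y) @ \oo --> image_density y.
Proof. by have [] := geometric_tail theta0 theta1 (image_term_bound y). Qed.

Lemma image_density_tail y N :
  `|image_density y - series (fun m => b m * rdipole c (s * u m) y) N|
  <= B * theta ^+ N / (1 - theta).
Proof. by have [_] := geometric_tail theta0 theta1 (image_term_bound y). Qed.

Lemma measurable_image_series N :
  measurable_fun [set: plane] (fun y => series (fun m => b m * rdipole c (s * u m) y) N).
Proof.
elim: N => [|N IH].
  rewrite (_ : (fun _ => _) = cst 0); first exact: measurable_cst.
  by apply/funext => y; rewrite seriesEnat /= big_geq.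
rewrite (_ : (fun _ => _) = (fun y => series (fun m => b m * rdipole c (s * u m) y) N +
   b N * rdipole c (s * u N) y)); last by apply/funext => y; rewrite seriesSr.
apply: measurable_funD => //; apply: measurable_funM; first exact: measurable_cst.
exact: measurable_rdipole.
Qed.

Lemma measurable_image_density : measurable_fun [set: plane] image_density.
Proof.
by apply: (measurable_fun_cvg measurable_image_series) => y _; exact: cvg_image_density.
Qed.

Lemma image_density_bounded y : `|image_density y| <= B / (1 - theta).
Proof.
have := image_density_tail y 0.
by rewrite expr0 mulr1 seriesEnat /= big_geq// subr0.
Qed.

(** The tail of the series is geometric uniformly in y, so it can be integrated against any kernel
    bounded on the circle. *)
Lemma cvg_Rintegral_image_density (k : plane -> R) (K : R) :
  measurable_fun setT k -> (forall y, circle c r y -> `|k y| <= K) ->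
  (fun N => \sum_(0 <= m < N) b m * \int[arclength c r]_y (k y * rdipole c (s * u m) y))
    @ \oo --> \int[arclength c r]_y (k y * image_density y).
Proof.
move=> mk kK; pose S N y := series (fun m => b m * rdipole c (s * u m) y) N.
(* The circle is not empty, so its point of parameter 0 shows that the bound is nonnegative. *)
have K0 : 0 <= K.
  by apply: le_trans (kK _ (circle_arc_param c 0 (ltW r0))).
have ikD m : (arclength c r).-integrable setT (EFin \o (fun y => k y * rdipole c (s * u m) y)).
  apply: (@integrable_bounded_circle _ _ _ _ (K * (1 - rho)^-1 ^+ 2) (ltW r0)).
    by apply: measurable_funM => //; exact: measurable_rdipole.
  move=> y cy; rewrite normrM ler_pM// ?kK//; exact: rdipole_le.
have kS N : (arclength c r).-integrable setT (EFin \o (fun y => k y * S N y)) /\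
   \int[arclength c r]_y (k y * S N y) =
   \sum_(0 <= m < N) b m * \int[arclength c r]_y (k y * rdipole c (s * u m) y).
  elim: N => [|N [IH1 IH2]].
    rewrite (_ : (fun y => k y * S 0 y) = cst 0); last first.
      by apply/funext => y; rewrite /S seriesEnat /= big_geq// mulr0.
    rewrite big_geq// Rintegral_arclength_cst ?mulr0 ?ltW//; split => //.
    exact: finite_measure_integrable_cst.
  have i1 : (arclength c r).-integrable setT
      (EFin \o (fun y => b N * (k y * rdipole c (s * u N) y))).
    exact: (integrableZl _ (b N) (ikD N)).
  rewrite (_ : (fun y => k y * S N.+1 y) =
    (fun y => k y * S N y + b N * (k y * rdipole c (s * u N) y))); last first.
    by apply/funext => y; rewrite /S seriesSr mulrDr; congr (_ + _); exact: mulrCA.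
  split; first exact: (integrableD measurableT IH1 i1).
  by rewrite RintegralD// RintegralZl// big_nat_recr//= -IH2.
have ikh : (arclength c r).-integrable setT (EFin \o (fun y => k y * image_density y)).
  apply: (@integrable_bounded_circle _ _ _ _ (K * (B / (1 - theta))) (ltW r0)).
    by apply: measurable_funM => //; exact: measurable_image_density.
  by move=> y cy; rewrite normrM ler_pM// ?kK//; exact: image_density_bounded.
apply: (@cvg_geometric_bound _ _ (2 * pi * r * (K * (B / (1 - theta)))) theta) => // N.
rewrite -(kS N).2 -RintegralB//; last exact: (kS N).1.
rewrite -mulrA -(Rintegral_arclength_cst c _ (ltW r0)); apply: le_ae_Rintegral.
- apply: measurable_funB; apply: measurable_funM => //.
    exact: measurable_image_density.
  exact: measurable_image_series.
- exact: finite_measure_integrable_cst.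
- apply: (ae_circle (ltW r0)) => y cy; rewrite -mulrBr normrM -[leRHS]mulrA ler_pM ?kK//.
  by rewrite mulrAC; exact: image_density_tail.
Qed.

End OneCircle.
End ImageSeries.

Section ImageSolution.
Variable R : realType.
Implicit Types (c v x y z : R * R) (q s t : R) (f : R * R -> R[i]).
Local Notation plane := (measurableTypeR R * measurableTypeR R)%type.

Lemma ReD (z w : R[i]) : complex.Re (z + w) = complex.Re z + complex.Re w.
Proof. by case: z w => ? ? []. Qed.

Lemma Rintegral_rdipole c (r q : R) : 0 < r -> `|q| < 1 ->
  \int[arclength c r]_y rdipole c q y = 0.
Proof.
by move=> r0 q1; have := bint_dipole c r0 (normcR_lt1 q1) => /(congr1 (@complex.Re R)).
Qed.

(** On the circle y.1 = c.1 + r Re z. The constant meets a density of mean zero, and in r Re z only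
    the mixed product contributes, with integral 2 pi r whatever the position of the pole. *)
Lemma Rintegral_abscissa_rdipole c (r q : R) : 0 < r -> `|q| < 1 ->
  \int[arclength c r]_y (y.1 * rdipole c q y) = pi * r ^+ 2.
Proof.
move=> r0 q1; have q1C := normcR_lt1 q1.
have bz := bmeas_dir c; have bD := bmeas_dipole c q1C.
have bzD : bmeas (fun y => dir c y * dipole c q%:C y) by exact: bmeasM.
have bzD' : bmeas (fun y => dir c y * conjc (dipole c q%:C y)).
  by apply: bmeasM => //; exact: bmeas_conj.
have bc : bmeas (fun y => (c.1)%:C * dipole c q%:C y) by exact: bmeasZ.
have bS := bmeasZ (r / 2)%:C (bmeasD bzD bzD').
transitivity (complex.Re (bint c r (fun y => (c.1)%:C * dipole c q%:C y +
   (r / 2)%:C * (dir c y * dipole c q%:C y + dir c y * conjc (dipole c q%:C y))))).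
  apply: (eq_circle_Rintegral (ltW r0)).
  - by apply: measurable_funM; [exact: measurable_fst|exact: measurable_rdipole].
  - by case: (bmeasD bc bS) => [[]].
  - move=> y cy; rewrite ReD.
    rewrite (_ : complex.Re (c.1%:C * dipole c q%:C y) = c.1 * rdipole c q y); last exact: ReZ.
    rewrite (_ : complex.Re ((r / 2)%:C * _) = r * (complex.Re (dir c y) * rdipole c q y)); last first.
      by rewrite ReZ /rdipole ReM -[LHS]mulrA.
    rewrite mulrA -mulrDl; congr (_ * _).
    have /(congr1 (@complex.Re R)) := dir_circle cy.
    have -> : toC (y - c) / r%:C = (r^-1)%:C * toC (y - c) by rewrite mulrC (fmorphV (real_complex R)).
    by rewrite ReZ => -> /=; field; rewrite gt_eqF.
rewrite bintD// bintZ// bint_dipole// mulr0 add0r bintZ; last exact: bmeasD.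
rewrite bintD// bint_dir_dipole// add0r.
rewrite (_ : (fun y => _) = (fun y => conjc (conjc (dir c y) * dipole c q%:C y))); last first.
  by apply/funext => y; rewrite conjcM conjcK.
rewrite bint_conj; last by apply: bmeasM => //; exact: bmeas_conj.
rewrite bint_conj_dir_dipole// conjc_real ReZ /=; move: (@pi R) => p.
by field.
Qed.

Variables (r L lam : R).
Hypotheses (r0 : 0 < r) (Lr : 2 * r < L) (lam2 : 2^-1 < `|lam|).
Local Notation u := (image_pos r L).
Local Notation b := (image_weight r L lam).
Local Notation h := (image_density r L lam).

Let lam0 : lam != 0. Proof. by rewrite -normr_gt0 (lt_trans _ lam2)// invr_gt0. Qed.

Let su1 s m : `|s| = 1 -> `|s * u m| < 1.
Proof.
move=> s1; have /andP[h0 _] := image_pos_bound r0 Lr m.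
by rewrite normrM s1 mul1r ger0_norm//; exact: image_pos_lt1.
Qed.

Lemma image_density_mean0 c s : `|s| = 1 -> mean_half c r (h c s) = 0.
Proof.
move=> s1; rewrite /mean_half.
have := @cvg_Rintegral_image_density _ _ _ _ r0 Lr lam2 c s s1 (cst 1) 1 (measurable_cst _).
under eq_Rintegral do rewrite mul1r.
have k1 y : circle c r y -> `|cst (1 : R) y| <= 1 by rewrite normr1.
move=> /(_ k1) H.
rewrite -(cvg_lim _ H)// (_ : (fun N => _) = cst 0) ?lim_cst ?mulr0//.
apply/funext => N; apply: big1 => m _.
under eq_Rintegral do rewrite mul1r.
by rewrite Rintegral_rdipole ?mulr0// su1.
Qed.

(** Reflection turns the m-th term on the opposite circle into lam times the (m + 1)-st term here.
    The layer potential is thus lam times the series without its first term, and lam * b 0 = 1. *)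
Lemma image_density_layer c c' s x : `|s| = 1 -> toC (c' - c) = (- (s * L))%:C ->
  circle c' r x ->
  layer c r (h c (- s)) (normal c' r x) x = lam * h c' s x - rdipole c' 0 x.
Proof.
move=> s1 cc cx; have sN1 : `|- s| = 1 by rewrite normrN.
have ss : s * s = 1 by rewrite -expr2 -real_normK ?num_real// s1 expr1n.
have L0 : 0 < L by have := r0; have := Lr; lra.
have sep : 2 * r < enorm (c - c').
  by rewrite -enormN opprB -normc_toC cc normcR normrN normrM s1 mul1r gtr0_norm.
have H := cvg_Rintegral_image_density r0 Lr lam2 sN1 (measurable_kern (normal c' r x) x)
  (fun y => kern_bound r0 sep cx).
have {}H : (fun N => (2 * pi)^-1 * \sum_(0 <= m < N) b m *
      \int[arclength c r]_y (kern (normal c' r x) x y * rdipole c (- s * u m) y))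
    @ \oo --> layer c r (h c (- s)) (normal c' r x) x by apply: cvgMr.
rewrite -(cvg_lim _ H)//.
have Hx : (fun N => lam * (series (fun m => b m * rdipole c' (s * u m) x) N.+1 - b 0 * rdipole c' (s * u 0) x))
   @ \oo --> lam * h c' s x - rdipole c' 0 x.
  rewrite (_ : lam * h c' s x - _ = lam * (h c' s x - b 0 * rdipole c' (s * u 0) x)); last first.
    by rewrite /= mulr0 mulrBr mulVKf.
  apply: cvgMr; apply: cvgB; last exact: cvg_cst.
  rewrite (cvg_shiftS (series (fun m => b m * rdipole c' (s * u m) x))).
  exact: cvg_image_density.
rewrite -(cvg_lim _ Hx)//; apply: (f_equal (fun g : nat -> R => lim (g @ \oo))).
apply/funext => N.
rewrite seriesEnat /= big_nat_recl// [in RHS]addrC addKr !mulr_sumr.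
apply: eq_bigr => m _.
have /andP[um0 um1] := image_pos_bound r0 Lr m.
have um := image_pos_lt1 r0 Lr m.
have Lu : L - r * u m != 0.
  have : r * u m <= r by rewrite ler_piMr// ltW.
  by move=> h1; rewrite gt_eqF//; have := r0; have := Lr; lra.
have D2 : 2 * r < `|- (s * L)| by rewrite normrN normrM s1 mul1r gtr0_norm.
have q1 : `|- s * u m| < 1 by apply: su1.
have := layer_rdipole r0 q1 cc D2 cx; rewrite /layer.
have s0 : s != 0 by rewrite -normr_gt0 s1.
(* The reflected parameter of [layer_rdipole] for D = - s L and q = - s u m; since s^2 = 1 it is s *
   u (m + 1), the recursion of [image_pos]. *)
rewrite (_ : - r / (- (s * L) - r * (- s * u m)) = s * u m.+1); last first.
  rewrite /= (_ : s * (r / _) = (s * s) * r / (s * (L - r * u m))); last by field; rewrite s0 Lu.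
  rewrite ss mul1r; field; rewrite Lu s0 /=.
  rewrite (_ : _ - _ = - (s * (L - r * u m))); last by ring.
  by rewrite oppr_eq0 mulf_neq0.
move=> e; rewrite mulrCA e image_weightS exprMn [s ^+ 2]ss mul1r.
move: (rdipole c' (s * u m.+1) x) (u m.+1) (b m) => D1 u1 b1.
by field; rewrite lam0.
Qed.

(** The diagonal term vanishes with the mean and the layer cancels all terms but the first, the
    uniform field, whose normal derivative is Re z. *)
Lemma image_density_solves c c' s x : `|s| = 1 -> toC (c' - c) = (- (s * L))%:C ->
  circle c' r x ->
  density_op lam c' r c (h c' s) (h c (- s)) x = complex.Re (dir c' x).
Proof.
move=> s1 cc cx; rewrite /density_op image_density_mean0// add0r (image_density_layer s1 cc cx).
by rewrite opprB addrCA subrr addr0 /rdipole /dipole /geo mul0r subr0 invr1 expr1n mulr1.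
Qed.

Lemma cvg_image_density_moment c s : `|s| = 1 ->
  series b @ \oo --> (pi * r ^+ 2)^-1 * \int[arclength c r]_y (y.1 * h c s y).
Proof.
move=> s1; have p0 : pi * r ^+ 2 != 0 by rewrite mulf_neq0// ?expf_neq0 ?gt_eqF// pi_gt0.
have yK (y : R * R) : circle c r y -> `|y.1| <= `|c.1| + r.
  move=> cy; rewrite -[y.1](subrK c.1) addrC (le_trans (ler_normD _ _))// lerD2l -cy.
  by rewrite -normc_toC; exact: (Re_le_normc (toC (y - c))).
have H := cvg_Rintegral_image_density r0 Lr lam2 s1 measurable_fst yK.
have {}H : (fun N => (pi * r ^+ 2)^-1 * \sum_(0 <= m < N) b m *
      \int[arclength c r]_y (y.1 * rdipole c (s * u m) y))
    @ \oo --> (pi * r ^+ 2)^-1 * \int[arclength c r]_y (y.1 * h c s y).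
  by apply: cvgMr.
rewrite (_ : series b = (fun N => (pi * r ^+ 2)^-1 * \sum_(0 <= m < N) b m *
      \int[arclength c r]_y (y.1 * rdipole c (s * u m) y)))//.
apply/funext => N; rewrite seriesEnat /= mulr_sumr; apply: eq_bigr => m _.
by rewrite Rintegral_abscissa_rdipole ?su1// mulrCA mulVf// mulr1.
Qed.

End ImageSolution.

(** * Evaluation of the series *)

Section Lambert.
Variable R : realType.
Implicit Types (e t z : R).

Lemma sum_natmul_expr z N : z != 1 ->
  \sum_(1 <= n < N.+1) n%:R * z ^+ n =
  z / (1 - z) ^+ 2 - z ^+ N.+1 * (N.+1%:R - N%:R * z) / (1 - z) ^+ 2.
Proof.
move=> z1; have d0 : 1 - z != 0 by rewrite subr_eq0 eq_sym.
elim: N => [|N IH]; first by rewrite big_geq// mul0r subr0 expr1 mulr1 subrr.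
by rewrite big_nat_recr//= IH !exprS -!natr1; field; rewrite ?d0.
Qed.

Lemma sum_expr z k : (\sum_(0 <= m < k) z ^+ m) * (1 - z) = 1 - z ^+ k.
Proof.
elim: k => [|k IH]; first by rewrite big_geq// mul0r subrr.
by rewrite big_nat_recr//= mulrDl IH exprS; ring.
Qed.

Lemma sum_expr_le z k : 0 <= z -> z < 1 -> \sum_(0 <= m < k) z ^+ m <= (1 - z)^-1.
Proof.
move=> z0 z1; have d0 : 0 < 1 - z by rewrite subr_gt0.
by rewrite -[leRHS]mul1r ler_pdivlMr// sum_expr gerBl exprn_ge0.
Qed.

(** Each of the n copies of e^n is at most e^m for some m < n, and these sum to a partial geometric
    series. *)
Lemma natmul_expr_le e n : 0 <= e -> e < 1 -> n%:R * e ^+ n <= (1 - e)^-1.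
Proof.
move=> e0 e1; have d0 : 0 < 1 - e by rewrite subr_gt0.
apply: le_trans (sum_expr_le n e0 e1).
rewrite (_ : n%:R * _ = \sum_(0 <= m < n) e ^+ n); last first.
  by rewrite sumr_const_nat subn0 mulr_natl.
by apply: ler_sum_nat => m /andP[_ mn]; apply: ler_wiXn2l => //; [exact: ltW|exact: ltnW].
Qed.

(** Meant for e = exp (- xi0) and t = 1 / (2 lam), by lam - x / 2 = lam * (1 - t x). *)
Definition lambert_term e t (n : nat) : R := n%:R * e ^+ (2 * n) / (1 - t * e ^+ (2 * n)).

Lemma expr_le_base e n : 0 <= e -> e < 1 -> (0 < n)%N -> e ^+ n <= e.
Proof. by move=> e0 e1 n0; rewrite -[leRHS]expr1 ler_wiXn2l// ltW. Qed.

Lemma lambert_den e t n : 0 <= e -> e < 1 -> `|t| < 1 -> 1 - `|t| <= 1 - t * e ^+ (2 * n).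
Proof.
move=> e0 e1 t1; rewrite lerD2l lerN2 (le_trans (ler_norm _))// normrM.
rewrite ler_piMr// ger0_norm ?exprn_ge0//; exact: exprn_ile1 (ltW e1).
Qed.

Lemma lambert_bound e t n : 0 <= e -> e < 1 -> `|t| < 1 ->
  `|lambert_term e t n| <= ((1 - e)^-1 / (1 - `|t|)) * e ^+ n.
Proof.
move=> e0 e1 t1; have d0 : 0 < 1 - `|t| by rewrite subr_gt0.
have d1 := lambert_den n e0 e1 t1; have d2 := lt_le_trans d0 d1.
rewrite normrM normfV (gtr0_norm d2) ger0_norm ?mulr_ge0 ?exprn_ge0//.
rewrite [leRHS]mulrAC; apply: ler_pM; rewrite ?invr_ge0 ?(ltW d2) ?mulr_ge0 ?exprn_ge0//; last by rewrite lef_pV2.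
by rewrite mul2n -addnn exprD mulrA ler_wpM2r ?exprn_ge0// natmul_expr_le.
Qed.

(* Expand [(1 - t * Q ^+ n)^-1] as a geometric series, [Q := e ^+ 2], exchange the
   two sums, and use [\sum_n n * z ^+ n = z / (1 - z) ^+ 2] at [z := Q ^+ m.+1]. *)
Lemma cvg_lambert e t : 0 < e -> e < 1 -> `|t| < 1 ->
  exists S : R, series (fun m => t ^+ m * e ^+ (2 * m.+1) / (1 - e ^+ (2 * m.+1)) ^+ 2) @ \oo --> S /\
    (fun N => \sum_(1 <= n < N.+1) lambert_term e t n) @ \oo --> S.
Proof.
move=> e0 e1 t1; have d0 : 0 < 1 - `|t| by rewrite subr_gt0.
have de : 0 < 1 - e by rewrite subr_gt0.
pose z m := e ^+ (2 * m.+1).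
have z0 m : 0 <= z m by rewrite exprn_ge0// ltW.
have ze m : z m <= e by apply: expr_le_base => //; exact: ltW.
have z1 m : 1 - e <= 1 - z m by rewrite lerD2l lerN2.
have z1' m : 0 < 1 - z m := lt_le_trans de (z1 m).
have zV m : (1 - z m)^-1 <= (1 - e)^-1 by rewrite lef_pV2 ?posrE.
have aB m : `|t ^+ m * z m / (1 - z m) ^+ 2| <= (1 - e)^-1 ^+ 2 * `|t| ^+ m.
  rewrite -mulrA normrM normrX mulrC ler_wpM2r ?exprn_ge0//.
  rewrite normrM normfV !ger0_norm ?exprn_ge0 ?(ltW (z1' m)) ?(ltW e0)//.
  rewrite (_ : ((1 - z m) ^+ 2)^-1 = (1 - z m)^-1 ^+ 2); last by rewrite exprVn.
  rewrite -[leRHS]mul1r ler_pM ?exprn_ge0 ?invr_ge0 ?(ltW (z1' m)) ?(ltW e0)//.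
    by rewrite (le_trans (ze m))// ltW.
  by rewrite ler_pXn2r ?nnegrE ?invr_ge0 ?(ltW de) ?(ltW (z1' m)).
have [ca _] := geometric_tail (normr_ge0 t) t1 aB.
set S := limn _ in ca *; exists S; split => //.
apply: (@cvg_geometric_bound _ _ _ ((1 - e)^-1 ^+ 3 / (1 - `|t|)) e (ltW e0) e1) => N.
(* Truncating the geometric series at M leaves two finite sums to exchange. The error bound below is
   uniform in M, so M can go to infinity with N fixed. *)
pose T M := \sum_(1 <= n < N.+1) n%:R * e ^+ (2 * n) * series (geometric 1 (t * e ^+ (2 * n))) M.
have cT : T @ \oo --> \sum_(1 <= n < N.+1) lambert_term e t n.
  apply: cvg_big => [|n _]; first exact: add_continuous.
  apply: cvgMr.
  rewrite -[X in _ --> X]mul1r; apply: cvg_geometric_series.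
  rewrite normrM (le_lt_trans _ t1)// ler_piMr// ger0_norm ?exprn_ge0 ?(ltW e0)//.
  by rewrite exprn_ile1 ?(ltW e0) ?(ltW e1).
have TE M : T M = \sum_(0 <= m < M) t ^+ m * \sum_(1 <= n < N.+1) n%:R * z m ^+ n.
  rewrite /T; under eq_bigr do rewrite seriesEnat /= mulr_sumr.
  rewrite exchange_big_nat /=; apply: eq_bigr => m _.
  rewrite mulr_sumr; apply: eq_bigr => n _.
  rewrite /geometric /= mul1r exprMn /z -!exprM.
  rewrite (_ : (2 * m.+1 * n = 2 * n + 2 * n * m)%N); last by lia.
  by rewrite exprD; ring.
have dB M : `|series (fun m => t ^+ m * z m / (1 - z m) ^+ 2) M - T M| <=
    (1 - e)^-1 ^+ 3 / (1 - `|t|) * e ^+ N.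
  rewrite seriesEnat /= TE -sumrB (le_trans (ler_norm_sum _ _ _))//.
  apply: (@le_trans _ _ (\sum_(0 <= m < M) `|t| ^+ m * ((1 - e)^-1 ^+ 3 * e ^+ N))).
    apply: ler_sum => m _; rewrite -mulrA -mulrBr normrM normrX ler_wpM2l ?exprn_ge0//.
    rewrite sum_natmul_expr; last by rewrite lt_eqF// -subr_gt0.
    rewrite opprB addrC subrK.
    have w0 : 0 <= N.+1%:R - N%:R * z m.
      rewrite -natr1 addrAC addr_ge0// subr_ge0 ler_piMr//.
      by rewrite (le_trans (ze m)) ?ltW.
    have w1 : N.+1%:R - N%:R * z m <= N.+1%:R by rewrite gerBl mulr_ge0.
    (* The exponent 2 (m + 1) (N + 1) exceeds 2 N + 1. The factor e^N gives the rate, and e^(N+1)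
       absorbs the factor N + 1. *)
    have zN : z m ^+ N.+1 <= e ^+ N * e ^+ N.+1.
      rewrite -exprD /z -exprM ler_wiXn2l ?ltW//; last by lia.
    rewrite normrM normfV !ger0_norm ?mulr_ge0 ?exprn_ge0 ?(ltW (z1' m)) ?(ltW e0)//.
    rewrite (_ : ((1 - z m) ^+ 2)^-1 = (1 - z m)^-1 ^+ 2); last by rewrite exprVn.
    rewrite (_ : (1 - e)^-1 ^+ 3 * e ^+ N = e ^+ N * (1 - e)^-1 * (1 - e)^-1 ^+ 2); last by ring.
    apply: ler_pM; rewrite ?mulr_ge0 ?exprn_ge0 ?invr_ge0 ?(ltW (z1' m)) ?(ltW e0)//.
      apply: (@le_trans _ _ (e ^+ N * e ^+ N.+1 * N.+1%:R)).
        by apply: ler_pM => //; rewrite exprn_ge0.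
      rewrite -mulrA ler_wpM2l ?exprn_ge0 ?(ltW e0)// mulrC natmul_expr_le//.
      exact: ltW.
    by rewrite ler_pXn2r ?nnegrE ?invr_ge0 ?(ltW de) ?(ltW (z1' m)).
  rewrite -mulr_suml mulrC [leRHS]mulrAC.
  by rewrite ler_wpM2l ?mulr_ge0 ?exprn_ge0 ?invr_ge0 ?(ltW de) ?(ltW e0)// sum_expr_le.
have cD : (fun M => `|series (fun m => t ^+ m * z m / (1 - z m) ^+ 2) M - T M|) @ \oo -->
   `|S - \sum_(1 <= n < N.+1) lambert_term e t n|.
  by apply: cvg_norm; apply: cvgB.
rewrite -(cvg_lim _ cD)//; apply: limr_le; first by apply/cvg_ex; eexists; exact: cD.
exact: nearW.
Qed.

End Lambert.

(** * Unordered summation over the nonzero integers *)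

Section Bilateral.
Variable R : realType.
Local Notation I := {n : int | n != 0}.

(** Index k stands for k + 1, and in [negI] for -(k + 1), which is [Negz k]; both have absolute
    value k + 1. *)
Definition posI (k : nat) : I := exist _ (Posz k.+1) isT.
Definition negI (k : nat) : I := exist _ (Negz k) isT.

Lemma posI_inj : injective posI. Proof. by move=> j k [->]. Qed.
Lemma negI_inj : injective negI. Proof. by move=> j k [->]. Qed.

Lemma nonzero_intP (i : I) : {k | i = posI k} + {k | i = negI k}.
Proof.
case: i => -[[//|k]|k] h; [left; exists k|right; exists k]; exact: val_inj.
Qed.

Lemma partial_sum_nonzero_int (f : I -> R) (A : {fset I}) K :
  (forall i, i \in A -> (absz (val i) <= K)%N) ->
  summability.partial_sum f A =
  \sum_(0 <= k < K | posI k \in A) f (posI k) + \sum_(0 <= k < K | negI k \in A) f (negI k).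
Proof.
move=> AK; rewrite /summability.partial_sum.
rewrite -(big_seq_fsetE _ A xpredT f) /=.
pose E := [seq posI k | k <- iota 0 K] ++ [seq negI k | k <- iota 0 K].
have uE : uniq E.
  rewrite cat_uniq !map_inj_uniq ?iota_uniq//=; last exact: posI_inj.
    rewrite andbT; apply/hasPn => x /mapP[k _ ->]; apply/mapP => -[j _].
    by move=> /(congr1 val).
  exact: negI_inj.
rewrite (perm_big [seq i <- E | i \in A]) /=; last first.
  apply: uniq_perm; [exact: fset_uniq|exact: filter_uniq|] => i.
  rewrite mem_filter; have [iA|//] := boolP (i \in A); rewrite andTb; apply/esym.
  have := AK i iA; rewrite mem_cat; case: (nonzero_intP i) => -[k ->] kK.
    by rewrite map_f// mem_iota.
  by rewrite orbC map_f// mem_iota.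
by rewrite big_filter big_cat !big_map /index_iota subn0.
Qed.

(** Convergence is along all finite index sets. Once a set contains every i with |i| <= N, each half
    misses only terms beyond N, and these are controlled by a geometric tail however they are
    scattered. *)
Lemma cvg_bilateral (a : nat -> R) (C q : R) (f : I -> R) : 0 <= q -> q < 1 ->
  (forall n, `|a n.+1| <= C * q ^+ n) -> (forall i, f i = a (absz (val i))) ->
  summability.partial_sum f @ summability.totally --> 2 * limn (series (fun n => a n.+1)).
Proof.
move=> q0 q1 aC fa; have [ca tail] := geometric_tail q0 q1 aC.
have q1' : 0 < 1 - q by rewrite subr_gt0.
have C0 : 0 <= C by have := aC 0; rewrite expr0 mulr1; exact: le_trans.
set l := limn _.
(* The 4 counts two signs, each with the terms missing below K and the tail above K. *)
have h : (fun N => 4 * (C * q ^+ N / (1 - q))) @ \oo --> 0.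
  rewrite -[X in _ --> X](mulr0 (4 * (C / (1 - q)))).
  rewrite (_ : (fun N => _) = (fun N => 4 * (C / (1 - q)) * q ^+ N)).
    by apply: cvgMr; apply: cvg_expr; rewrite ger0_norm.
  by apply/funext => N; rewrite -!mulrA [_^-1 * _]mulrC.
have FF : ProperFilter (@summability.totally I) := summability.totally_filter.
apply/cvgrPdist_le => e e0.
move/cvgrPdist_le : h => /(_ _ e0)[N _ /(_ N (leqnn N))]; rewrite sub0r normrN => hN.
have {}hN : 4 * (C * q ^+ N / (1 - q)) <= e by exact: le_trans (ler_norm _) hN.
pose A0 := seq_fset tt ([seq posI k | k <- iota 0 N] ++ [seq negI k | k <- iota 0 N]).
exists A0 => // A A0A.
have pA k : (k < N)%N -> posI k \in A.
  move=> kN; apply: (fsubsetP A0A); rewrite seq_fsetE mem_cat map_f//.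
  by rewrite mem_iota.
have nA k : (k < N)%N -> negI k \in A.
  move=> kN; apply: (fsubsetP A0A); rewrite seq_fsetE mem_cat orbC map_f//.
  by rewrite mem_iota.
pose K := maxn N (\max_(i <- enum_fset A) absz (val i)).
have AK i : i \in A -> (absz (val i) <= K)%N.
  by move=> iA; rewrite leq_max; apply/orP; right; apply: leq_bigmax_seq.
rewrite /= (partial_sum_nonzero_int f AK).
have one (P : pred nat) (g : nat -> R) : (forall k, (k < N)%N -> P k) -> (forall k, g k = a k.+1) ->
    `|l - \sum_(0 <= k < K | P k) g k| <= 2 * (C * q ^+ N / (1 - q)).
  move=> PN ga; under eq_bigr do rewrite ga.
  (* [a'] keeps exactly the terms absent from the set; it vanishes below N. *)
  pose a' k : R := if P k then 0 else a k.+1.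
  have a'C k : `|a' k| <= C * q ^+ k.
    by rewrite /a'; case: ifP => // _; rewrite normr0 mulr_ge0// exprn_ge0.
  have NK : (N <= K)%N by exact: leq_maxl.
  rewrite (_ : \sum_(0 <= k < K | P k) a k.+1 =
      series (fun k => a k.+1) K - \sum_(N <= k < K) a' k); last first.
    have -> : \sum_(N <= k < K) a' k = \sum_(0 <= k < K) a' k.
      rewrite [RHS](big_cat_nat (n := N))//= [X in _ = X + _]big_nat_cond [X in _ = X + _]big1 ?add0r//.
      by move=> k; rewrite andbT => /andP[_ kN]; rewrite /a' PN.
    rewrite seriesEnat /= -sumrB big_mkcond; apply: eq_bigr => k _.
    by rewrite /a'; case: ifP; rewrite ?subr0 ?subrr.
  rewrite opprB addrA [l + _]addrC -addrA (le_trans (ler_normD _ _))// mulr_natl mulr2n lerD//.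
    exact: sum_geometric_le.
  rewrite (le_trans (tail K))// ler_pM2r ?invr_gt0// ler_wpM2l//.
  by rewrite ler_wiXn2l// ltW.
rewrite (_ : 2 * l - _ = (l - \sum_(0 <= k < K | posI k \in A) f (posI k)) +
  (l - \sum_(0 <= k < K | negI k \in A) f (negI k))); last by ring.
rewrite (le_trans (ler_normD _ _))// (le_trans _ hN)//.
rewrite (_ : 4 * _ = 2 * (C * q ^+ N / (1 - q)) + 2 * (C * q ^+ N / (1 - q))); last by ring.
by apply: lerD; apply: one => // k; rewrite fa.
Qed.

End Bilateral.

(** * The polarization tensor of two disks *)

Section TwoDisks.
Variable R : realType.
Local Notation plane := (measurableTypeR R * measurableTypeR R)%type.
Implicit Types (r eps lam k e : R).

Lemma Lfun2_bounded d (T : measurableType d) (mu : {finite_measure set T -> \bar R})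
    (f : T -> R) (M : R) :
  measurable_fun setT f -> (forall x, `|f x| <= M) -> f \in Lfun mu 2%:E.
Proof.
move=> mf fM; rewrite inE; apply/andP; split; rewrite inE/=; first exact: mf.
rewrite /finite_norm unlock poweR_lty//.
under eq_integral => x _/= do rewrite powR_mulrn//.
apply/integrable_lty => //.
apply: (@ae_integrable _ _ _ _ (fun x => `|f x| ^+ 2) (cst (M ^+ 2))).
- by apply: measurable_funX; exact: measurableT_comp.
- apply: aeW => x; rewrite normrX normr_id ler_pXn2r ?nnegrE//.
  exact: le_trans (fM x).
- exact: finite_measure_integrable_cst.
Qed.

Lemma bL2_cintegrable c r (f : R * R -> R[i]) : bL2 c r f -> cintegrable c r f.
Proof.
have fin : arclength c r setT \is a fin_num by exact: fin_num_measure.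
move=> [fR fI].
have mR : measurable_fun [set: plane] (fun y => complex.Re (f y)).
  by move: fR; rewrite inE => /andP[/[!inE]/= mR _].
have mI : measurable_fun [set: plane] (fun y => complex.Im (f y)).
  by move: fI; rewrite inE => /andP[/[!inE]/= mI _].
by split => //; split; apply/Lfun1_integrable; apply: Lfun_subset12.
Qed.

(** This is |k - 1| < k + 1, true for every positive k. *)
Lemma conductivity_ratio k : 0 < k -> k != 1 -> 2^-1 < `|(k + 1) / (2 * (k - 1))|.
Proof.
move=> k0 k1; have d0 : 0 < `|k - 1| by rewrite normr_gt0 subr_eq0.
rewrite normrM normfV normrM (ger0_norm (_ : (0 : R) <= 2))// (gtr0_norm (_ : 0 < k + 1)) ?addr_gt0//.
rewrite invfM mulrCA -[ltLHS]mulr1 ltr_pM2l ?invr_gt0// ltr_pdivlMr// mul1r.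
by rewrite ltr_norml; apply/andP; split; lra.
Qed.

Section Bipolar.
Variables (r eps : R).
Hypotheses (r0 : 0 < r) (e0 : 0 < eps).
Local Notation L := (2 * r + eps).
Local Notation e := (expR (- xi0 r eps)).

Let a0 : 0 < alpha r eps.
Proof. by rewrite sqrtr_gt0 mulr_gt0// addr_gt0// divr_gt0. Qed.

Lemma sqr_alpha : alpha r eps ^+ 2 = eps * (r + eps / 4).
Proof. by rewrite sqr_sqrtr// mulr_ge0 ?addr_ge0 ?divr_ge0 ?ltW. Qed.

Lemma sinh_xi0 : e^-1 - e = 2 * alpha r eps / r.
Proof.
have := asinhK (alpha r eps / r); rewrite -/(xi0 r eps) /sinh => h.
by rewrite -expRN opprK -mulrA -h mulrCA divff ?mulr1.
Qed.

Lemma exp_xi0_lt1 : e < 1.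
Proof.
have h : 0 < e^-1 - e by rewrite sinh_xi0 divr_gt0// mulr_gt0.
have p := expR_gt0 (- xi0 r eps); rewrite ltNge; apply: contraTN h => h.
by rewrite -leNgt subr_le0 (le_trans _ h)// invf_le1.
Qed.

(** From alpha^2 + r^2 = (r + eps / 2)^2, which also makes (alpha, 0) and (- alpha, 0) the limiting
    points of the two circles. The distance between the centers is therefore r * (e^-1 + e). *)
Lemma cosh_xi0 : e^-1 + e = L / r.
Proof.
have p := expR_gt0 (- xi0 r eps); have h := sinh_xi0.
have c0 : 0 <= e^-1 + e by rewrite addr_ge0// ?invr_ge0 ltW.
have l0 : 0 <= L / r by rewrite divr_ge0 ?addr_ge0 ?mulr_ge0 ?(ltW r0) ?(ltW e0).
apply/eqP; rewrite -(eqrXn2 (isT : (0 < 2)%N) c0 l0).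
apply/eqP; rewrite (_ : (e^-1 + e) ^+ 2 = (e^-1 - e) ^+ 2 + 4); last by field; rewrite gt_eqF.
rewrite h (_ : (2 * alpha r eps / r) ^+ 2 = 4 * alpha r eps ^+ 2 / r ^+ 2); last by field; rewrite gt_eqF.
by rewrite sqr_alpha; field; rewrite gt_eqF.
Qed.

Let en1 n : 1 - e ^+ (2 * n.+1) != 0.
Proof.
rewrite subr_eq0 eq_sym lt_eqF//; have := expr_le_base (expR_ge0 _) exp_xi0_lt1 (isT : (0 < 2 * n.+1)%N).
by move=> h; exact: le_lt_trans h exp_xi0_lt1.
Qed.

(* This is [sinh (m * xi0) / sinh (m.+1 * xi0)]. *)
Lemma image_posE m : image_pos r L m = e * (1 - e ^+ (2 * m)) / (1 - e ^+ (2 * m.+1)).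
Proof.
have p : e != 0 by rewrite gt_eqF// expR_gt0.
elim: m => [|m IH]; first by rewrite /= expr0 subrr mulr0 mul0r.
(* With this value of L, the map u -> r / (L - r u) has fixed points e and e^-1, whence a closed
   form in powers of e. *)
rewrite /= IH (_ : L = r * (e^-1 + e)); last by rewrite cosh_xi0 mulrCA divff ?mulr1// gt_eqF.
have h1 := en1 m; have h2 := en1 m.+1.
have E1 (n : nat) : e ^+ (2 * n.+1) = e ^+ 2 * e ^+ (2 * n) by rewrite mulnS exprD.
rewrite !E1 in h1 h2 *; move: (e ^+ (2 * m)) h1 h2 => z h1 h2.
have rr : r != 0 by rewrite gt_eqF.
field; rewrite ?p ?rr ?h1 ?h2 /=.
rewrite (_ : _ + _ = r * (1 - e ^+ 2 * (e ^+ 2 * z))); last by ring.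
by rewrite mulf_neq0.
Qed.

(** The squared positions telescope. The factor depending on m is the summand of [cvg_lambert] at t
    = 1 / (2 lam). *)
Lemma image_weightE lam m : lam != 0 ->
  image_weight r L lam m = (1 - e ^+ 2) ^+ 2 / (lam * e ^+ 2) *
    ((2 * lam)^-1 ^+ m * e ^+ (2 * m.+1) / (1 - e ^+ (2 * m.+1)) ^+ 2).
Proof.
move=> l0; have p : e != 0 by rewrite gt_eqF// expR_gt0.
elim: m => [|m IH].
  have h1 := en1 0; rewrite muln1 in h1 *; rewrite /= expr0.
  by field; rewrite p l0 h1.
have h1 := en1 m; have h2 := en1 m.+1.
rewrite image_weightS IH image_posE [_^-1 ^+ m.+1]exprS.
have E1 (n : nat) : e ^+ (2 * n.+1) = e ^+ 2 * e ^+ (2 * n) by rewrite mulnS exprD.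
rewrite (E1 m.+1) in h2 *; move: (e ^+ (2 * m.+1)) (_ ^+ m) h1 h2 => z w h1 h2.
by field; rewrite p l0 h1 h2.
Qed.

(** This is alpha = r sinh xi0; it turns the prefactor of [image_weightE] into that of the final
    series. *)
Lemma sqr_alphaE : alpha r eps ^+ 2 = r ^+ 2 * (1 - e ^+ 2) ^+ 2 / (4 * e ^+ 2).
Proof.
have p : e != 0 by rewrite gt_eqF// expR_gt0.
have -> : alpha r eps = r * (e^-1 - e) / 2 by rewrite sinh_xi0; field; rewrite gt_eqF.
by field; rewrite p.
Qed.

Lemma expR_xi0 (n : nat) : expR (- (2 * n%:R * xi0 r eps)) = e ^+ (2 * n).
Proof. by rewrite -mulrN -expRM_natl natrM. Qed.

Lemma lambda_den lam (x : R) : lam != 0 -> lam - 2^-1 * x = lam * (1 - (2 * lam)^-1 * x).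
Proof. by move=> l0; field; rewrite l0. Qed.

Lemma m11_partial_sumE lam N : lam != 0 ->
  m11_partial_sum r eps lam N = lam^-1 * \sum_(1 <= n < N.+1) lambert_term e (2 * lam)^-1 n.
Proof.
move=> l0; rewrite /m11_partial_sum mulr_sumr; apply: eq_bigr => n _.
by rewrite expR_xi0 (lambda_den _ l0) invfM /lambert_term mulrCA mulrA.
Qed.

Lemma m11_termE lam (n : {n : int | n != 0}) : lam != 0 ->
  m11_term r eps lam n = 4 * pi * alpha r eps ^+ 2 / lam *
    lambert_term e (2 * lam)^-1 (absz (val n)).
Proof.
move=> l0; rewrite /m11_term /lambda_plus /lambert_term.
rewrite (_ : `|val n|%:~R = (absz (val n))%:R :> R); last by rewrite -abszE.
rewrite expR_xi0 (lambda_den _ l0) invfM.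
move: (pi : R) (alpha r eps ^+ 2) (_ %:R) (e ^+ _) (1 - _)^-1 => *; ring.
Qed.

End Bipolar.

Section RealOperator.
Implicit Types (c : R * R) (u v : R * R -> R).

Lemma layerB c r u v w x : 0 < r -> r < enorm (x - c) ->
  measurable_fun [set: plane] u -> (arclength c r).-integrable setT (EFin \o u) ->
  measurable_fun [set: plane] v -> (arclength c r).-integrable setT (EFin \o v) ->
  layer c r (fun y => u y - v y) w x = layer c r u w x - layer c r v w x.
Proof.
move=> r0 xr mu iu mv iv; rewrite /layer -mulrBr; congr (_ * _).
have ik (f : R * R -> R) : measurable_fun [set: plane] f ->
    (arclength c r).-integrable setT (EFin \o f) ->
    (arclength c r).-integrable setT (EFin \o (fun y => kern w x y * f y)).
  move=> mf jf; pose K := enorm w / (enorm (x - c) - r).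
  apply: (ae_integrable _ _ (integrableZl _ K (integrable_norm jf))) => //.
    by apply: measurable_funM => //; exact: measurable_kern.
  apply: (ae_circle (ltW r0)) => y cy; rewrite normrM ler_wpM2r//.
  have d0 : 0 < enorm (x - c) - r by rewrite subr_gt0.
  have d1 := circle_far x cy.
  rewrite (le_trans (kern_le _ _ _))// ler_wpM2l ?enorm_ge0// lef_pV2 ?posrE//.
  exact: lt_le_trans d0 d1.
rewrite -RintegralB//; [|exact: ik..].
by apply: eq_Rintegral => y _; rewrite mulrBr.
Qed.

Lemma density_opB lam c c' r (u v u' v' : plane -> R) x : 0 < r -> r < enorm (x - c') ->
  (arclength c r).-integrable setT (EFin \o u) ->
  (arclength c r).-integrable setT (EFin \o v) ->
  measurable_fun setT u' -> (arclength c' r).-integrable setT (EFin \o u') ->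
  measurable_fun setT v' -> (arclength c' r).-integrable setT (EFin \o v') ->
  density_op lam c r c' (fun y => u y - v y) (fun y => u' y - v' y) x =
  density_op lam c r c' u u' x - density_op lam c r c' v v' x.
Proof.
move=> r0 xr iu iv mu' iu' mv' iv'.
rewrite /density_op (layerB _ r0 xr)// /mean_half RintegralB//; ring.
Qed.

Lemma density_op0 lam c c' r x : density_op lam c r c' (cst 0) (cst 0) x = 0.
Proof.
rewrite /density_op /mean_half /layer mulr0.
under [X in _ - (_ + _ * X)]eq_Rintegral do rewrite mulr0.
by rewrite !Rintegral_cst// !mul0r !mulr0 addr0 subr0.
Qed.

End RealOperator.

Section Solvability.
Variables (r eps lam : R).
Hypotheses (r0 : 0 < r) (e0 : 0 < eps) (lam2 : 2^-1 < `|lam|).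
Local Notation c1 := (center1 r eps).
Local Notation c2 := (center2 r eps).
Local Notation L := (2 * r + eps).

Let sep12 : 2 * r < enorm (c2 - c1). Proof. by rewrite enorm_center// ltrDl. Qed.
Let sep21 : 2 * r < enorm (c1 - c2). Proof. by rewrite -opprB enormN. Qed.

Lemma eq_density_op (u1 u2 v1 v2 : plane -> R) :
  measurable_fun setT u1 -> (arclength c1 r).-integrable setT (EFin \o u1) ->
  measurable_fun setT u2 -> (arclength c2 r).-integrable setT (EFin \o u2) ->
  measurable_fun setT v1 -> (arclength c1 r).-integrable setT (EFin \o v1) ->
  measurable_fun setT v2 -> (arclength c2 r).-integrable setT (EFin \o v2) ->
  {ae arclength c1 r, forall x, density_op lam c1 r c2 u1 u2 x = density_op lam c1 r c2 v1 v2 x} ->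
  {ae arclength c2 r, forall x, density_op lam c2 r c1 u2 u1 x = density_op lam c2 r c1 v2 v1 x} ->
  {ae arclength c1 r, forall x, u1 x = v1 x} /\ {ae arclength c2 r, forall x, u2 x = v2 x}.
Proof.
move=> mu1 iu1 mu2 iu2 mv1 iv1 mv2 iv2 e1 e2.
have [] := @density_system_inj _ lam c1 c2 r (fun x => u1 x - v1 x) (fun x => u2 x - v2 x) r0 sep12 lam2.
- exact: measurable_funB.
- exact: (integrableB measurableT iu1 iv1).
- exact: measurable_funB.
- exact: (integrableB measurableT iu2 iv2).
- apply: aeS2 (ae_circle (ltW r0) (fun x (cx : circle c1 r x) => cx)) e1 => x cx h.
  by rewrite density_opB// ?h ?subrr//; exact: circle_sep cx sep12.
- apply: aeS2 (ae_circle (ltW r0) (fun x (cx : circle c2 r x) => cx)) e2 => x cx h.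
  by rewrite density_opB// ?h ?subrr//; exact: circle_sep cx sep21.
- by move=> h1 h2; split; [apply: aeS h1|apply: aeS h2] => x /eqP; rewrite subr_eq0 => /eqP.
Qed.

Lemma eqL2_preimages (g h h' : density2 R) :
  preimages r eps lam g h -> preimages r eps lam g h' -> eqL2 r eps h' h.
Proof.
move=> [[h1 h2] [e1 e2]] [[h'1 h'2] [e'1 e'2]].
have i1 := bL2_cintegrable h1; have i2 := bL2_cintegrable h2.
have i'1 := bL2_cintegrable h'1; have i'2 := bL2_cintegrable h'2.
have E1 : {ae arclength c1 r, forall x, (resolvent_op r eps lam h').1 x = (resolvent_op r eps lam h).1 x}.
  by apply: aeS2 e1 e'1 => x -> // ->.
have E2 : {ae arclength c2 r, forall x, (resolvent_op r eps lam h').2 x = (resolvent_op r eps lam h).2 x}.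
  by apply: aeS2 e2 e'2 => x -> // ->.
have C1 := ae_circle (ltW r0) (fun x (cx : circle c1 r x) => cx).
have C2 := ae_circle (ltW r0) (fun x (cx : circle c2 r x) => cx).
have F1 x : circle c1 r x -> (resolvent_op r eps lam h').1 x = (resolvent_op r eps lam h).1 x ->
    density_op lam c1 r c2 (fun y => complex.Re (h'.1 y)) (fun y => complex.Re (h'.2 y)) x =
    density_op lam c1 r c2 (fun y => complex.Re (h.1 y)) (fun y => complex.Re (h.2 y)) x /\
    density_op lam c1 r c2 (fun y => complex.Im (h'.1 y)) (fun y => complex.Im (h'.2 y)) x =
    density_op lam c1 r c2 (fun y => complex.Im (h.1 y)) (fun y => complex.Im (h.2 y)) x.
  by move=> cx; rewrite !resolvent_op1E// => -[].
have F2 x : circle c2 r x -> (resolvent_op r eps lam h').2 x = (resolvent_op r eps lam h).2 x ->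
    density_op lam c2 r c1 (fun y => complex.Re (h'.2 y)) (fun y => complex.Re (h'.1 y)) x =
    density_op lam c2 r c1 (fun y => complex.Re (h.2 y)) (fun y => complex.Re (h.1 y)) x /\
    density_op lam c2 r c1 (fun y => complex.Im (h'.2 y)) (fun y => complex.Im (h'.1 y)) x =
    density_op lam c2 r c1 (fun y => complex.Im (h.2 y)) (fun y => complex.Im (h.1 y)) x.
  by move=> cx; rewrite !resolvent_op2E// => -[].
case: i1 i2 i'1 i'2 => [[mR1 mI1] [iR1 iI1]] [[mR2 mI2] [iR2 iI2]]
  [[mR'1 mI'1] [iR'1 iI'1]] [[mR'2 mI'2] [iR'2 iI'2]].
have [|| R1 R2] := eq_density_op mR'1 iR'1 mR'2 iR'2 mR1 iR1 mR2 iR2.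
- by apply: aeS2 C1 E1 => x cx e; exact: (F1 x cx e).1.
- by apply: aeS2 C2 E2 => x cx e; exact: (F2 x cx e).1.
have [|| I1 I2] := eq_density_op mI'1 iI'1 mI'2 iI'2 mI1 iI1 mI2 iI2.
- by apply: aeS2 C1 E1 => x cx e; exact: (F1 x cx e).2.
- by apply: aeS2 C2 E2 => x cx e; exact: (F2 x cx e).2.
have eqC (z w : R[i]) : complex.Re z = complex.Re w -> complex.Im z = complex.Im w -> z = w.
  by case: z w => ? ? [? ?] /= -> ->.
split.
- by apply: aeS2 R1 I1 => x e f _; exact: eqC.
- by apply: aeS2 R2 I2 => x e f _; exact: eqC.
Qed.

Definition image_solution : density2 R :=
  (fun x => (image_density r L lam c1 1 x)%:C, fun x => (image_density r L lam c2 (-1) x)%:C).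

Let Lr : 2 * r < L. Proof. by rewrite ltrDl. Qed.

Lemma image_density_bL2 c s : `|s| = 1 -> bL2 c r (fun x => (image_density r L lam c s x)%:C).
Proof.
move=> s1; split => /=; last exact: Lfun_cst.
have h1 := measurable_image_density r0 Lr lam2 c s1.
exact: (@Lfun2_bounded _ _ (arclength c r) _ _ h1 (image_density_bounded r0 Lr lam2 c s1)).
Qed.

Lemma image_solution_preimage : preimages r eps lam (psi r eps) image_solution.
Proof.
have s1 : `|1 : R| = 1 := normr1 R; have sN1 : `|-1 : R| = 1 by rewrite normrN normr1.
have l1 := image_density_bL2 c1 s1; have l2 := image_density_bL2 c2 sN1.
have i1 := bL2_cintegrable l1; have i2 := bL2_cintegrable l2.
have toC12 : toC (c1 - c2) = (- (1 * L))%:C.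
  by apply/eqP; rewrite eq_complex /= subrr eqxx andbT; apply/eqP; field.
have toC21 : toC (c2 - c1) = (- (-1 * L))%:C.
  by apply/eqP; rewrite eq_complex /= subrr eqxx andbT; apply/eqP; field.
split; first by split; [exact: l1|exact: l2].
split.
- apply: (ae_circle (ltW r0)) => x cx _.
  rewrite (@resolvent_op1E R r eps lam image_solution x r0 e0 cx i1 i2) /=.
  rewrite (image_density_solves r0 Lr lam2 s1 toC12 cx).
  by rewrite [X in _ +i* X]density_op0 -(toC_normal cx).
- apply: (ae_circle (ltW r0)) => x cx _.
  rewrite (@resolvent_op2E R r eps lam image_solution x r0 e0 cx i1 i2) /=.
  have := image_density_solves r0 Lr lam2 sN1 toC21 cx; rewrite opprK => ->.
  by rewrite [X in _ +i* X]density_op0 -(toC_normal cx).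
Qed.

(** The chosen resolvent is known only almost everywhere to be a real density, which suffices for
    the value of the pairing. *)
Lemma bint_abscissa c (f : R * R -> R[i]) (v : R * R -> R) :
  cmeasurable f -> measurable_fun [set: plane] v ->
  f = (fun x => (v x)%:C) %[ae arclength c r] ->
  bint c r (fun x => (x.1)%:C * conjc (f x)) = (\int[arclength c r]_x (x.1 * v x))%:C.
Proof.
move=> mf mv fv; have mx : cmeasurable (fun x : R * R => (x.1)%:C).
  by apply: cmeasurable_real; exact: measurable_fst.
have [mR mI] := cmeasurableM mx (cmeasurable_conj mf).
rewrite /bint; congr Complex.
- apply: eq_ae_Rintegral => //; first by apply: measurable_funM => //; exact: measurable_fst.
  by apply: aeS fv => x -> //=; rewrite mul0r subr0.
- transitivity (\int[arclength c r]_x 0); last by rewrite Rintegral_arclength_cst ?mulr0 ?ltW.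
  apply: eq_ae_Rintegral; [exact: mI|exact: measurable_cst|].
  by apply: aeS fv => x -> //=; rewrite mul0r oppr0 mulr0 addr0.
Qed.

Lemma m11E : m11 r eps lam =
  (2 * pi * r ^+ 2 * limn (series (image_weight r L lam)))%:C.
Proof.
have s1 : `|1 : R| = 1 := normr1 R; have sN1 : `|-1 : R| = 1 by rewrite normrN normr1.
have pre := image_solution_preimage.
(* Existence ensures that [xget] returns a preimage and not its default; uniqueness then identifies
   it with the image solution almost everywhere. *)
have pre' : preimages r eps lam (psi r eps) (resolvent r eps lam (psi r eps)).
  by rewrite /resolvent; apply: xgetPex; exists image_solution.
have [q1 q2] := eqL2_preimages pre pre'.
have [[l1 l2] _] := pre'.
have [m1 _] := bL2_cintegrable l1; have [m2 _] := bL2_cintegrable l2.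
rewrite /m11 /pairing.
rewrite (bint_abscissa m1 (measurable_image_density r0 Lr lam2 c1 s1) q1).
rewrite (bint_abscissa m2 (measurable_image_density r0 Lr lam2 c2 sN1) q2).
have p0 : pi * r ^+ 2 != 0 by rewrite mulf_neq0// ?expf_neq0 ?gt_eqF// pi_gt0.
have -> : \int[arclength c1 r]_x (x.1 * image_density r L lam c1 1 x) =
    pi * r ^+ 2 * limn (series (image_weight r L lam)).
  by rewrite (cvg_lim _ (@cvg_image_density_moment R r L lam r0 Lr lam2 c1 1 s1))// mulVKf.
have -> : \int[arclength c2 r]_x (x.1 * image_density r L lam c2 (-1) x) =
    pi * r ^+ 2 * limn (series (image_weight r L lam)).
  by rewrite (cvg_lim _ (@cvg_image_density_moment R r L lam r0 Lr lam2 c2 (-1) sN1))// mulVKf.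
by rewrite -rmorphD; congr (_%:C); move: (pi : R) => p; ring.
Qed.

End Solvability.
End TwoDisks.

(** [resolvent] and [lim] take default values when there is no solution or no limit, so unique
    solvability and both convergences belong to the conclusion. The sum over nonzero integers is
    taken along all finite subsets. *)
Theorem proposition3p3 (R : realType) (r eps k : R) :
  0 < r -> 0 < eps -> 0 < k -> k != 1 ->
  let lam := (k + 1) / (2 * (k - 1)) in
  let bilateral := summability.partial_sum (@m11_term R r eps lam) in
  let unilateral := m11_partial_sum r eps lam in
  [/\ uniquely_solvable r eps lam (psi r eps),
      cvg (bilateral @ summability.totally),
      cvg (unilateral @ \oo),
      m11 r eps lam = (lim (bilateral @ summability.totally))%:C &
      m11 r eps lam =
        (8 * pi * alpha r eps ^+ 2 * lim (unilateral @ \oo))%:C ].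
Proof.
move=> r0 e0 k0 k1 lam bilateral unilateral.
have lam2 : 2^-1 < `|lam| by exact: conductivity_ratio.
have lam0 : lam != 0 by rewrite -normr_gt0 (lt_trans _ lam2)// invr_gt0.
pose e := expR (- xi0 r eps); pose t := (2 * lam)^-1.
have ee0 : 0 < e by exact: expR_gt0.
have ee1 : e < 1 by exact: exp_xi0_lt1.
have t1 : `|t| < 1.
  rewrite normfV normrM (ger0_norm (_ : (0 : R) <= 2))// invf_lt1 ?mulr_gt0 ?normr_gt0//.
  by rewrite -ltr_pdivrMl// mulr1.
have [S [cb cS]] := cvg_lambert ee0 ee1 t1.
have cU : unilateral @ \oo --> lam^-1 * S.
  rewrite (_ : unilateral = (fun N => lam^-1 * \sum_(1 <= n < N.+1) lambert_term e t n)).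
    exact: cvgMr.
  by apply/funext => N; exact: m11_partial_sumE.
pose C := 4 * pi * alpha r eps ^+ 2 / lam.
have cB : bilateral @ summability.totally --> 2 * (C * S).
  have aC n : `|C * lambert_term e t n.+1| <= `|C| * ((1 - e)^-1 / (1 - `|t|)) * e ^+ n.
    rewrite normrM -mulrA ler_wpM2l// (le_trans (lambert_bound n.+1 (ltW ee0) ee1 t1))//.
    rewrite ler_wpM2l ?divr_ge0 ?invr_ge0 ?subr_ge0 ?(ltW ee1) ?(ltW t1)//.
    by rewrite exprS ler_piMl ?exprn_ge0 ?(ltW ee0) ?(ltW ee1).
  have := cvg_bilateral (a := fun n => C * lambert_term e t n) (ltW ee0) ee1 aC
    (fun n => m11_termE r eps n lam0).
  rewrite (_ : limn _ = C * S)//; apply: cvg_lim => //.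
  rewrite (_ : series _ = (fun N => C * \sum_(1 <= n < N.+1) lambert_term e t n)).
    exact: cvgMr.
  by apply/funext => N; rewrite seriesEnat /= big_add1 mulr_sumr.
have mS : m11 r eps lam = (8 * pi * alpha r eps ^+ 2 * (lam^-1 * S))%:C.
  rewrite m11E//; congr (_%:C).
  (* Multiplied by 2 pi r^2, this prefactor is 8 pi alpha^2 / lam by [sqr_alphaE]. *)
  rewrite (_ : limn _ = (1 - e ^+ 2) ^+ 2 / (lam * e ^+ 2) * S).
    rewrite sqr_alphaE// -/e; have en : e != 0 by rewrite gt_eqF.
    by move: (pi : R) => p; field; rewrite lam0 en.
  apply: cvg_lim => //.
  rewrite (_ : series _ = (fun N => (1 - e ^+ 2) ^+ 2 / (lam * e ^+ 2) *
    series (fun m => t ^+ m * e ^+ (2 * m.+1) / (1 - e ^+ (2 * m.+1)) ^+ 2) N)).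
    exact: cvgMr.
  apply/funext => N; rewrite !seriesEnat /= mulr_sumr; apply: eq_bigr => m _.
  exact: image_weightE.
have FF : ProperFilter (@summability.totally {n : int | n != 0}) := summability.totally_filter.
split.
- exists (image_solution r eps lam); first exact: image_solution_preimage.
  by move=> h'; apply: eqL2_preimages => //; exact: image_solution_preimage.
- by apply/cvg_ex; exists (2 * (C * S)).
- by apply/cvg_ex; exists (lam^-1 * S).
- rewrite mS (cvg_lim _ cB)//; congr (_%:C); rewrite /C.
  move: (pi : R) (alpha r eps ^+ 2) => p a; by field; rewrite lam0.
- by rewrite mS (cvg_lim _ cU).
Qed.
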